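(* Let $X$ and $Y$ be separable Hilbert spaces. Let $D_\sigma : X \to X$ be a bounded, linear, self-adjoint operator that is positive definite, bounded from below (there is $c>0$ with $\|D_\sigma x\| \ge c\|x\|$ for all $x \in X$) and contractive ($\|D_\sigma\| < 1$), so that $\operatorname{spec}(D_\sigma) \subset (0,1)$. Let $A : X \to Y$ be a bounded linear operator with $\|A\| = 1$. Let $\{h_\tau : \mathbb{R} \to \mathbb{R}\}_{\tau \in (0,\infty)}$ be a family of continuous functions such that (A.1) $h_\tau(\operatorname{spec}(D_\sigma)) \subset (0,1)$ for every $\tau > 0$; (A.2) the functions $r_\tau(\lambda) := \dfrac{1 - h_\tau(\lambda)}{\tau\, h_\tau(\lambda)}$ converge uniformly for $\lambda \in \operatorname{spec}(D_\sigma)$ as $\tau \to 0$ to a limit $r^*$, with rate $\|r_\tau - r^*\|_{L^\infty(\operatorname{spec}(D_\sigma))} = o(\tau)$ as $\tau \to 0$; (A.3) $\underline{c} := \inf_{\tau > 0,\, \lambda \in \operatorname{spec}(D_\sigma)} r_\tau(\lambda) > 0$ and $\overline{c} := \sup_{\tau > 0,\, \lambda \in \operatorname{spec}(D_\sigma)} r_\tau(\lambda) < \infty$. For $\tau > 0$ and $x \in X$ define $$J_\tau(x) := \frac{1}{2} \langle x, (h_\tau(D_\sigma)^{-1} - \mathrm{id})x \rangle = \frac{\tau}{2} \langle x, r_\tau(D_\sigma) x \rangle .$$ Then the following hold. (1) For every $\tau > 0$ and every $y \in Y$, the solution of the variational problem $$\hat{x} = \operatorname*{arg\,min}_{x \in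 X} \frac{1}{2}\|Ax - y\|^2 + J_\tau(x)$$ can be computed by the PnP-FBS iteration, that is, $$\hat{x} = \lim_{k \to \infty} x_k, \qquad \text{where } x_{k+1} = h_\tau(D_\sigma)\bigl(x_k - A^*(A x_k - y)\bigr).$$ (2) The limit $J^*(x) := \lim_{\tau \to 0} J_\tau(x)/\tau$ exists for every $x \in X$. Moreover, let $x^* \in X$, let $y = A x^*$, let $\{y^\delta\}_{\delta > 0} \subset Y$ satisfy $\|y^\delta - y\| \le \delta$ for every $\delta>0$, let $\tau^\delta > 0$ be chosen such that $\tau^\delta \sim \delta$, and let $$\hat{x}(y^\delta, \tau^\delta) = \operatorname*{arg\,min}_{x \in X} \frac{1}{2}\|Ax - y^\delta\|^2 + J_{\tau^\delta}(x).$$ Then $\hat{x}(y^\delta, \tau^\delta) \to x^\dagger$ in $X$ as $\delta \to 0$, where $$x^\dagger = \operatorname*{arg\,min}_{x \in X \text{ s.t. } A^*(Ax - y) = 0} J^*(x)$$ is the $J^*$-minimizing least squares solution of $Ax = y$.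
   Context: $\operatorname{spec}(D_\sigma)$ denotes the spectrum of $D_\sigma$, $\mathrm{id}$ the identity operator on $X$, and $A^*$ the Hilbert-space adjoint of $A$. Norms and inner products are those of the Hilbert spaces $X$ and $Y$; operator norms are the induced ones. For a scalar function $h$ continuous on $\operatorname{spec}(D_\sigma)$, $h(D_\sigma)$ is defined by the continuous functional calculus for the self-adjoint operator $D_\sigma$. The PnP-FBS iteration (plug-and-play forward-backward splitting) is started from an arbitrary $x_0 \in X$, and its limit is in the norm of $X$. The parameter choice $\tau^\delta \sim \delta$ means that $\tau^\delta$ is of the same order as $\delta$ as $\delta \to 0$: there are constants $0 < c_1 \le c_2$ such that $c_1 \delta \le \tau^\delta \le c_2 \delta$ for all sufficiently small $\delta > 0$. Convergence $\hat{x}(y^\delta,\tau^\delta)\to x^\dagger$ is convergence in the norm of $X$. *)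

(* Defs.v *)
From HB Require Import structures.
From mathcomp Require Import all_boot all_order all_algebra.
From mathcomp Require Import all_classical all_reals all_analysis.
Set Implicit Arguments.
Unset Strict Implicit.
Unset Printing Implicit Defensive.
Import Order.TTheory GRing.Theory Num.Theory.
Import numFieldNormedType.Exports.
Local Open Scope classical_set_scope.
Local Open Scope ring_scope.

(* Scalars are real.  A complex Hilbert space is also a [hilbertType] for the
   inner product Re <x, y>: the norm, adjoints, the (real) spectrum of a
   self-adjoint operator and its functional calculus by real functions are
   unchanged by this restriction of scalars, and <x, T x> is real for T
   self-adjoint. *)
HB.mixin Record CompleteNormedModule_isHilbert (R : realType) V
    of CompleteNormedModule R V := {
  inner : V -> V -> R;
  innerC : forall x y, inner x y = inner y x;
  innerDl : forall x y z, inner (x + y) z = inner x z + inner y z;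
  innerZl : forall a x y, inner (a *: x) y = a * inner x y;
  innerxx : forall x, inner x x = `|x| ^+ 2
}.

#[short(type="hilbertType")]
HB.structure Definition Hilbert (R : realType) :=
  {V of CompleteNormedModule_isHilbert R V & CompleteNormedModule R V}.

Definition separable (T : topologicalType) :=
  exists S : set T, countable S /\ dense S.

Section operators.
Variable R : realType.
Implicit Types X Y : hilbertType R.

Definition opnorm X Y (A : X -> Y) : R :=
  sup [set `|A x| | x in [set x : X | `|x| <= 1]].

(* For A bounded linear the Riesz theorem provides exactly one such x. *)
Definition adjoint X Y (A : X -> Y) (y : Y) : X :=
  xget 0 [set x | forall u, inner (A u) y = inner u x].

Definition self_adjoint X (D : X -> X) := forall x y, inner (D x) y = inner x (D y).

(* The inverse of T, when T is bijective. *)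
Definition op_inv X (T : X -> X) (y : X) : X := xget 0 [set x | T x = y].

(* Real spectrum; it is the whole spectrum when D is self-adjoint. *)
Definition spec X (D : X -> X) : set R :=
  [set l | ~ exists S : {linear X -> X}, continuous S /\
             (forall x, S (D x - l *: x) = x) /\
             (forall x, D (S x) - l *: S x = x)].

Definition op_horner X (D : X -> X) (p : {poly R}) (x : X) : X :=
  \sum_(i < size p) p`_i *: iter i D x.

Definition poly_approx (S : set R) (f : R -> R) : set_system {poly R} :=
  filter_from [set e : R | 0 < e]
    (fun e => [set p : {poly R} | forall l, S l -> `|p.[l] - f l| < e]).

(* Continuous functional calculus f(D): the limit of p(D) as the polynomial p
   tends to f uniformly on spec D.  For D bounded self-adjoint and f continuous
   on spec D, the filter is proper by Weierstrass' theorem, and p(D) converges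
   (even in operator norm) since ||p(D)|| is the maximum of |p| on spec D. *)
Definition cfc X (D : X -> X) (f : R -> R) (x : X) : X :=
  lim (op_horner D p x @[p --> poly_approx (spec D) f]).

Definition argmin (T : Type) (C : set T) (F : T -> R) : set T :=
  [set x | C x /\ forall z, C z -> F x <= F z].

Definition r_fun (h : R -> R -> R) (tau l : R) : R :=
  (1 - h tau l) / (tau * h tau l).

Definition r_values X (D : X -> X) (h : R -> R -> R) : set R :=
  [set z | exists tau l, [/\ 0 < tau, spec D l & z = r_fun h tau l]].

Definition J_fun X (D : X -> X) (h : R -> R -> R) (tau : R) (x : X) : R :=
  2^-1 * inner x (op_inv (cfc D (h tau)) x - x).

Definition J_star X (D : X -> X) (h : R -> R -> R) (x : X) : R :=
  lim (J_fun D h tau x / tau @[tau --> 0^'+]).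

Definition objective X Y (A : X -> Y) (D : X -> X) (h : R -> R -> R)
    (tau : R) (y : Y) (x : X) : R :=
  2^-1 * `|A x - y| ^+ 2 + J_fun D h tau x.

Definition pnp_fbs X Y (A : X -> Y) (D : X -> X) (h : R -> R -> R)
    (tau : R) (y : Y) (x : X) : X :=
  cfc D (h tau) (x - adjoint A (A x - y)).

End operators.

(* Main.v *)
From HB Require Import structures.
Require Import Defs.
From mathcomp Require Import all_boot all_order all_algebra.
From mathcomp Require Import all_classical all_reals all_analysis.
From mathcomp Require Import ring lra complex.
Set Implicit Arguments.
Unset Strict Implicit.
Unset Printing Implicit Defensive.
Import Order.TTheory GRing.Theory Num.Theory.
Import numFieldNormedType.Exports.
Local Open Scope classical_set_scope.
Local Open Scope ring_scope.

(** Write [H := h_tau(D)] and [S := r_tau(D)].  On the spectrum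
    [h_tau * (1 + tau * r_tau) = 1], so [H] is invertible with inverse
    [id + tau * S], the penalty is [tau / 2 * <x, S x>], and the bounds
    [c <= r_tau <= C] give [c |x|^2 <= <x, S x>] and [|S x| <= C |x|], uniformly
    in [tau].

    All of this rests on the functional calculus.  Its key inequality is
    [|p(D) x| <= sup_(spec D) |p| * |x|] for a real polynomial [p]
    ([op_horner_le]): with [M] the norm of [p(D)], the operator
    [M^2 - p(D)^2] is not bounded below; factoring [M^2 - p^2] over the reals,
    some linear factor [D - l] is not bounded below either (the irreducible
    quadratic factors are coercive), so [l] is a spectral value with
    [|p(l)| = M].  The inequality makes the polynomials of [D] Cauchy along
    uniform approximation on the spectrum, and linearity, multiplicativity,
    symmetry and bounds pass to the limit.  Approximating polynomials exist for
    continuous functions by the Bernstein construction ([weierstrass]), because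
    the spectrum lies in the unit interval: [D - l] is definite for [l] outside
    of it, hence invertible by the Lax-Milgram theorem.

    For the iteration: on the spectrum [h_tau <= 1 / (1 + tau * c) < 1], and
    [id - A^* A] is nonexpansive since [|A| = 1], so the iteration is a
    contraction.  Its fixed point [p] satisfies
    [p + tau * S p = p - A^* (A p - y)], which is the Euler equation of the
    strongly convex functional ([tikhonov_argmin]).

    For the regularization: the forms [<x, r_tau(D) x>] converge to [<x, S* x>] with
    [S* := r^*(D)], uniformly on bounded sets.  The minimizer [xd] of this
    coercive form over the solutions of [A x = y] exists by completeness, and
    [S* xd] is orthogonal to the kernel of [A], hence is a limit of vectors
    [A^* w] ([orth_ker_adjoint]).  Strong convergence of the regularized
    solutions [x] then comes without any weak compactness, from
    [<x - xd, S* (x - xd)> = <x, S* x> - <xd, S* xd> - 2 <x - xd, S* xd>]: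
    comparing the functional at [x] and [xd] bounds the first difference by
    [delta^2 / tau] up to small terms and shows [A x -> y], while the last
    product is [<A x - y, w>] up to small terms ([tikhonov_error]). *)

(** * Inner products, bounded operators, least norm elements *)

Section inner_product.
Variables (R : realType) (X : hilbertType R).
Implicit Types x y z : X.

Lemma innerDr x y z : inner x (y + z) = inner x y + inner x z.
Proof. by rewrite innerC innerDl !(innerC x). Qed.

Lemma innerZr (a : R) x y : inner x (a *: y) = a * inner x y.
Proof. by rewrite innerC innerZl innerC. Qed.

Lemma innerNl x y : inner (- x) y = - inner x y.
Proof. by rewrite -scaleN1r innerZl mulN1r. Qed.

Lemma innerNr x y : inner x (- y) = - inner x y.
Proof. by rewrite innerC innerNl innerC. Qed.

Lemma innerBl x y z : inner (x - y) z = inner x z - inner y z.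
Proof. by rewrite innerDl innerNl. Qed.

Lemma innerBr x y z : inner x (y - z) = inner x y - inner x z.
Proof. by rewrite innerDr innerNr. Qed.

Lemma inner0l x : inner 0 x = 0.
Proof. by rewrite -(subrr 0) innerBl subrr. Qed.

Lemma inner0r x : inner x 0 = 0.
Proof. by rewrite innerC inner0l. Qed.

Lemma sqr_normB x y : `|x - y| ^+ 2 = `|x| ^+ 2 - 2 * inner x y + `|y| ^+ 2.
Proof. rewrite -!innerxx innerBl !innerBr (innerC y x); ring. Qed.

Lemma sqr_normD x y : `|x + y| ^+ 2 = `|x| ^+ 2 + 2 * inner x y + `|y| ^+ 2.
Proof. rewrite -!innerxx innerDl !innerDr (innerC y x); ring. Qed.

(** The square of the norm of [`|y| *: x - `|x| *: y] is nonnegative. *)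
Lemma inner_le x y : inner x y <= `|x| * `|y|.
Proof.
have [->|x0] := eqVneq x 0; first by rewrite inner0l normr0 mul0r.
have [->|y0] := eqVneq y 0; first by rewrite inner0r normr0 mulr0.
have nx : 0 < `|x| by rewrite normr_gt0.
have ny : 0 < `|y| by rewrite normr_gt0.
have : 0 <= `|(`|y| *: x - `|x| *: y)| ^+ 2 by rewrite sqr_ge0.
rewrite sqr_normB !normrZ !normr_id innerZl innerZr => H.
have {}H : 0 <= (2 * (`|x| * `|y|)) * (`|x| * `|y| - inner x y) by nra.
by move: H; rewrite pmulr_rge0 ?subr_ge0// !mulr_gt0.
Qed.

Lemma abs_inner_le x y : `|inner x y| <= `|x| * `|y|.
Proof.
rewrite ler_norml inner_le andbT lerNl -innerNl.
by rewrite (le_trans (inner_le _ _))// normrN.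
Qed.

Lemma inner_eq x y : (forall u, inner u x = inner u y) -> x = y.
Proof.
move=> H; apply/eqP; rewrite -subr_eq0 -normr_eq0 -sqrf_eq0 -innerxx.
by rewrite innerBr H subrr.
Qed.

End inner_product.

(** A vector identity holds as soon as it holds in every scalar product, where
    it becomes an identity between real numbers. *)
Ltac vector_ring :=
  apply: inner_eq => ?;
  rewrite ?(innerDr, innerNr, innerZr, inner0r); (ring || by field).

Section inner_limits.
Variables (R : realType) (X : hilbertType R).

Lemma inner_cvg (T : Type) (F : set_system T) (FF : Filter F) (f g : T -> X) x y :
  f @ F --> x -> g @ F --> y -> inner (f t) (g t) @[t --> F] --> inner x y.
Proof.
move=> fx gy.
(* Polarization turns the inner product into norms of sums. *)
have E (a b : X) : inner a b = 4^-1 * (`|a + b| * `|a + b| - `|a - b| * `|a - b|).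
  by rewrite -(expr2 `|a + b|) -(expr2 `|a - b|) sqr_normD sqr_normB; field.
rewrite E; under eq_fun do rewrite E.
have nD : `|f t + g t| @[t --> F] --> `|x + y| by apply: cvg_norm; exact: cvgD.
have nB : `|f t - g t| @[t --> F] --> `|x - y| by apply: cvg_norm; exact: cvgB.
by apply: cvgMr; apply: cvgB; apply: cvgM.
Qed.

End inner_limits.

Section bounded_operators.
Variables (R : realType).

Lemma continuous_linear_le (V W : normedModType R) (f : {linear V -> W}) :
  continuous f -> exists2 M : R, 0 < M & forall x, `|f x| <= M * `|x|.
Proof.
move=> cf.
have /linear_boundedP := (linear_bounded_continuous f).2 cf.
by move=> /pinfty_ex_gt0 [M M0 H]; exists M.
Qed.

Lemma le_continuous_linear (V W : normedModType R) (f : {linear V -> W}) (M : R) :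
  (forall x, `|f x| <= M * `|x|) -> continuous f.
Proof.
move=> H; apply: bounded_linear_continuous; apply/linear_boundedP.
exists M; split; first exact: num_real.
by move=> r Mr x; rewrite (le_trans (H x))// ler_wpM2r// ltW.
Qed.

Lemma le_opnorm (X Y : hilbertType R) (f : {linear X -> Y}) x :
  continuous f -> `|f x| <= opnorm f * `|x|.
Proof.
move=> /continuous_linear_le[M M0 HM].
have [->|x0] := eqVneq x 0; first by rewrite linear0 !normr0 mulr0.
have nx : 0 < `|x| by rewrite normr_gt0.
rewrite -ler_pdivrMr//.
apply: ub_le_sup.
  exists M => _ [z /= z1 <-]; rewrite (le_trans (HM z))//.
  by rewrite -[leRHS]mulr1 ler_wpM2l// ltW.
exists (`|x|^-1 *: x); rewrite /= ?linearZ/= normrZ ger0_norm ?invr_ge0//.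
  by rewrite mulVf// gt_eqF.
by rewrite mulrC.
Qed.

Lemma opnorm_le (X Y : hilbertType R) (f : X -> Y) (M : R) :
  0 <= M -> (forall x, `|f x| <= M * `|x|) -> opnorm f <= M.
Proof.
move=> M0 HM; apply: ge_sup; first by exists `|f 0|, 0 => //=; rewrite normr0.
move=> _ [z /= z1 <-]; rewrite (le_trans (HM z))//.
by rewrite -[leRHS]mulr1 ler_wpM2l.
Qed.

End bounded_operators.

Section energy.
Variables (R : realType) (X : hilbertType R).

(** By the parallelogram identity two near-minimizers are close to each other, so
    the near-minimizers form a Cauchy filter, whose limit is a minimizer. *)
Lemma energy_argmin (C : set X) (N : X -> R) (c : R) :
  closed C -> C !=set0 -> (forall x y, C x -> C y -> C (2^-1 *: (x + y))) ->
  0 < c -> (forall x, c * `|x| ^+ 2 <= N x) -> continuous N ->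
  (forall x y, N (x - y) = 2 * N x + 2 * N y - 4 * N (2^-1 *: (x + y))) ->
  exists x, argmin C N = [set x].
Proof.
move=> clC [z0 Cz0] mid c0 coer contN par.
have N0 x : 0 <= N x by rewrite (le_trans _ (coer x))// mulr_ge0 ?sqr_ge0 ?ltW.
pose m := inf (N @` C).
have hinf : has_inf (N @` C).
  by split; [exists (N z0), z0|exists 0 => _ [x _ <-]].
have mle x : C x -> m <= N x.
  by move=> Cx; apply: ge_inf; [case: hinf|exists x].
have mclose x y e : C x -> C y -> N x <= m + e -> N y <= m + e ->
    c * `|x - y| ^+ 2 <= 4 * e.
  move=> Cx Cy Nx Ny; rewrite (le_trans (coer _))// par.
  have := mle _ (mid _ _ Cx Cy); lra.
pose B e := [set x | C x /\ N x <= m + e].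
pose F := filter_from [set e : R | 0 < e] B.
have FB e : 0 < e -> F (B e) by move=> e0; exists e.
have FF : ProperFilter F.
  apply: filter_from_proper; last first.
    move=> e /= e0; have [_ [x Cx <-] H] := inf_adherent e0 hinf.
    by exists x; split => //; apply: ltW.
  apply: filter_from_filter; first by exists 1 => /=.
  move=> e1 e2 /= e10 e20; exists (Num.min e1 e2).
    by rewrite /= lt_min e10.
  move=> x [Cx Nx]; split; split => //; rewrite (le_trans Nx)// lerD2l.
    by rewrite ge_min lexx.
  by rewrite ge_min lexx orbT.
have /cauchy_cvgP : cauchy F.
  apply: cauchy_exP => e e0.
  pose d := c * (e / 2) ^+ 2 / 4.
  have d0 : 0 < d by rewrite /d divr_gt0// mulr_gt0// exprn_gt0// divr_gt0.
  have [x [Cx Nx]] : B d !=set0 by apply: filter_ex (FB _ d0).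
  exists x; apply: filterS (FB _ d0) => y [Cy Ny].
  rewrite -ball_normE /ball_ /=.
  have := mclose _ _ _ Cx Cy Nx Ny; rewrite /d.
  have -> : 4 * (c * (e / 2) ^+ 2 / 4) = c * (e / 2) ^+ 2 by field.
  rewrite ler_pM2l// ler_sqr ?nnegrE// ?divr_ge0 ?(ltW e0)//.
  by move=> /le_lt_trans; apply; rewrite ltr_pdivrMr// ltr_pMr// ltr1n.
move=> /cvg_ex[x Fx].
have Cx : C x.
  have := @closed_cvg _ _ F FF id C clC _ x Fx; apply.
  by apply: filterS (FB 1 ltr01) => y [].
have Nx : N x <= m.
  apply/ler_addgt0Pr => e e0.
  have cl : closed [set r : R | r <= m + e] by apply: closed_le.
  have NFx : N @ F --> N x by apply: cvg_comp Fx (contN x).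
  have := @closed_cvg _ _ F FF N _ cl _ (N x) NFx; apply.
  by apply: filterS (FB e e0) => y [].
exists x; apply/seteqP; split => [y [Cy Hy] /=|y -> /=].
  have Ny : N y <= m + 0 by rewrite addr0 (le_trans (Hy _ Cx)).
  have := mclose x y 0 Cx Cy; rewrite addr0 => /(_ Nx) ; rewrite -{1}(addr0 m).
  move=> /(_ Ny); rewrite mulr0 pmulr_rle0// => H.
  have : `|x - y| ^+ 2 == 0 by rewrite eq_le H sqr_ge0.
  by rewrite sqrf_eq0 normr_eq0 subr_eq0 => /eqP.
by split => // z Cz; rewrite (le_trans Nx) ?mle.
Qed.

(** A linear lower-order term [t * b] would beat [t ^+ 2 * a] for small [t]. *)
Lemma linear_coef_eq0 (a b : R) : (forall t, 0 <= t ^+ 2 * a + 2 * t * b) -> b = 0.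
Proof.
move=> H; apply/eqP/negPn/negP => b0.
have b2 : 0 < b ^+ 2 by rewrite lt_neqAle sqr_ge0 andbT eq_sym sqrf_eq0.
have a1 : 0 < `|a| + 1 by rewrite ltr_wpDl.
have := H (- b / (`|a| + 1)).
have -> : (- b / (`|a| + 1)) ^+ 2 * a + 2 * (- b / (`|a| + 1)) * b =
   b ^+ 2 / (`|a| + 1) ^+ 2 * (a - 2 * (`|a| + 1)).
  by field; rewrite gt_eqF.
rewrite pmulr_rge0; last by rewrite divr_gt0// exprn_gt0.
have := ler_norm a; have := normr_ge0 a; lra.
Qed.

Lemma sqr_norm_continuous : continuous (fun x : X => `|x| ^+ 2).
Proof.
by move=> x; under eq_fun do rewrite expr2; apply: cvgM; exact: norm_continuous.
Qed.

Lemma sqr_norm_midpoint (x y : X) :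
  `|x - y| ^+ 2 = 2 * `|x| ^+ 2 + 2 * `|y| ^+ 2 - 4 * `|2^-1 *: (x + y)| ^+ 2.
Proof.
rewrite normrZ exprMn sqr_normB sqr_normD ger0_norm ?invr_ge0 ?ler0n//.
by field.
Qed.

(** First order optimality for the norm: the minimizer is orthogonal to every
    direction along which it can move freely. *)
Lemma min_norm (C : set X) :
  closed C -> C !=set0 -> (forall x y, C x -> C y -> C (2^-1 *: (x + y))) ->
  exists2 x, C x & forall d, (forall t : R, C (x + t *: d)) -> inner x d = 0.
Proof.
move=> clC C0 mid.
have [|||x E] := @energy_argmin C (fun x => `|x| ^+ 2) 1 clC C0 mid ltr01.
- by move=> x; rewrite mul1r.
- exact: sqr_norm_continuous.
- exact: sqr_norm_midpoint.
have [Cx Hx] : argmin C (fun x => `|x| ^+ 2) x by rewrite E.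
exists x => // d Cd; apply: (@linear_coef_eq0 (`|d| ^+ 2)) => t.
have := Hx _ (Cd t); rewrite sqr_normD innerZr normrZ exprMn real_normK ?num_real//.
lra.
Qed.

(** The least norm element of the hyperplane [f = 1] is orthogonal to the kernel
    of [f]. *)
Lemma riesz (f : X -> R) : (forall a x y, f (a *: x + y) = a * f x + f y) ->
  continuous f -> exists x, forall u, f u = inner u x.
Proof.
move=> lf cf.
have f0 : f 0 = 0.
  by have := lf (-1) 0 0; rewrite scaler0 addr0 mulN1r addNr.
have fZ a w : f (a *: w) = a * f w by rewrite -[a *: w]addr0 lf f0 addr0.
have [fe0|] := pselect (forall u, f u = 0).
  by exists 0 => u; rewrite fe0 inner0r.
move=> /existsNP[v /eqP fv].
pose C := [set x | f x = 1].
have [||x y|x Cx Hx] := @min_norm C.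
- apply: (@preimage_closed _ _ f [set y | y = 1]); last exact: closed_eq.
  by move=> x _; exact: cf.
- by exists ((f v)^-1 *: v); rewrite /C /= fZ mulVf.
- rewrite /C /= => fx fy; rewrite fZ -[x in x + y]scale1r lf fx fy.
  by field.
have xx : inner x x != 0.
  rewrite innerxx sqrf_eq0 normr_eq0; apply/eqP => x0.
  by move: Cx; rewrite /C/= x0 f0 => /eqP; rewrite eq_sym oner_eq0.
exists ((inner x x)^-1 *: x) => u.
have : inner x (u - f u *: x) = 0.
  apply: Hx => t; rewrite /C/=.
  have -> : x + t *: (u - f u *: x) = (1 - t * f u) *: x + t *: u by vector_ring.
  by rewrite lf fZ Cx; ring.
rewrite innerBr innerZr => /eqP; rewrite subr_eq0 => /eqP.
by rewrite innerZr (innerC u) => ->; rewrite mulrCA mulVf// mulr1.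
Qed.

End energy.

(** * Adjoints *)

Section adjoint_operator.
Variables (R : realType) (X Y : hilbertType R) (A : {linear X -> Y}).
Hypothesis A_continuous : continuous A.

Lemma adjointE u y : inner (A u) y = inner u (adjoint A y).
Proof.
suff : exists x, forall u, inner (A u) y = inner u x.
  by move=> [x Hx]; rewrite /adjoint; case: xgetP => [z -> /= ->//|/(_ x)].
apply: (@riesz R X (fun u => inner (A u) y)) => [a v w|v].
  by rewrite linearP innerDl innerZl.
apply: inner_cvg; [exact: A_continuous|exact: cvg_cst].
Qed.

Lemma adjointP a y z : adjoint A (a *: y + z) = a *: adjoint A y + adjoint A z.
Proof. by apply: inner_eq => u; rewrite innerDr innerZr -!adjointE innerDr innerZr. Qed.

Lemma adjointB y z : adjoint A (y - z) = adjoint A y - adjoint A z.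
Proof. by rewrite addrC -scaleN1r adjointP scaleN1r addrC. Qed.

Lemma adjoint0 : adjoint A 0 = 0.
Proof. by rewrite -(subrr 0) adjointB subrr. Qed.

Lemma adjoint_le M y : 0 <= M -> (forall x, `|A x| <= M * `|x|) ->
  `|adjoint A y| <= M * `|y|.
Proof.
move=> M0 HM; have [->|a0] := eqVneq (adjoint A y) 0.
  by rewrite normr0 mulr_ge0.
have na : 0 < `|adjoint A y| by rewrite normr_gt0.
rewrite -(ler_pM2l na) -expr2 -innerxx -adjointE (le_trans (inner_le _ _))//.
by rewrite mulrA ler_wpM2r// mulrC.
Qed.

(** For a consistent equation the normal equation has no other solutions than the
    exact ones: [adjoint A (A x) = 0] gives [inner (A x) (A x) = 0]. *)
Lemma adjoint_range_eq0 x : adjoint A (A x) = 0 <-> A x = 0.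
Proof.
split=> [H|->]; last first.
  by apply: inner_eq => u; rewrite -adjointE !inner0r.
apply/eqP; rewrite -normr_eq0 -sqrf_eq0 -innerxx adjointE H inner0r.
by [].
Qed.

(** The residual of least norm of [v] against the range of the adjoint is
    orthogonal to that range, that is, it lies in the kernel of [A]; being also
    a limit of [v - adjoint A w], it is orthogonal to itself. *)
Lemma orth_ker_adjoint v : (forall x, A x = 0 -> inner v x = 0) ->
  forall e, 0 < e -> exists w, `|v - adjoint A w| < e.
Proof.
move=> vker.
pose C := [set x | forall e : R, 0 < e -> exists w, `|x - (v - adjoint A w)| < e].
have [|||x Cx Hx] := @min_norm R X C.
- move=> x clx e e0; have e20 : 0 < e / 2 by rewrite divr_gt0.
  have [y [Cy]] := clx _ (nbhsx_ballx x (e / 2) e20).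
  rewrite -ball_normE /ball_/= => xy; have [w Hw] := Cy _ e20; exists w.
  rewrite -(subrKA y) (le_lt_trans (ler_normD _ _))//; lra.
- exists v => e e0; exists 0; suff -> : adjoint A 0 = 0 by rewrite subr0 subrr normr0.
  by rewrite adjoint0.
- move=> x y Cx Cy e e0; have [w Hw] := Cx _ e0; have [z Hz] := Cy _ e0.
  exists (2^-1 *: w + 2^-1 *: z); rewrite adjointP -[_ *: z]addr0 adjointP.
  have -> : adjoint A 0 = 0 by rewrite adjoint0.
  set x' := adjoint A w; set y' := adjoint A z.
  have -> : 2^-1 *: (x + y) - (v - (2^-1 *: x' + (2^-1 *: y' + 0))) =
     2^-1 *: (x - (v - x')) + 2^-1 *: (y - (v - y')) by vector_ring.
  rewrite (le_lt_trans (ler_normD _ _))// !normrZ ger0_norm ?invr_ge0 ?ler0n//. lra.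
have Ax : A x = 0.
  apply: inner_eq => u; rewrite inner0r innerC adjointE; apply: Hx => t e e0.
  have [w Hw] := Cx _ e0; exists (w - t *: u).
  suff -> : adjoint A (w - t *: u) = adjoint A w - t *: adjoint A u.
    set a := adjoint A w in Hw *; set b := adjoint A u.
    by have <- : x - (v - a) = x + t *: b - (v - (a - t *: b)) by vector_ring.
  by rewrite adjointB -[t *: u]addr0 adjointP adjoint0 addr0.
have x0 : x = 0.
  apply/eqP; rewrite -normr_eq0 -sqrf_eq0 eq_le sqr_ge0 andbT.
  have nx1 : 0 < `|x| + 1 by rewrite ltr_wpDl.
  apply/ler_addgt0Pl => e e0; rewrite addr0.
  have [w] := Cx _ (divr_gt0 e0 nx1); rewrite ltr_pdivlMr// => Hw.
  have -> : `|x| ^+ 2 = inner (x - (v - adjoint A w)) x.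
    rewrite innerBl innerBl vker// (innerC (adjoint A w)) -adjointE Ax inner0l.
    by rewrite !subr0 innerxx.
  rewrite (le_trans (inner_le _ _))// (le_trans _ (ltW Hw))//.
  by rewrite ler_wpM2l// lerDl.
move=> e e0; have [w] := Cx _ e0; rewrite x0 sub0r normrN => Hw; by exists w.
Qed.

End adjoint_operator.

(** * Contractions, coercive operators, real spectrum *)

Section contraction_principle.
Variables (R : realType) (X : completeNormedModType R).

Lemma contraction_iterates (f : X -> X) (q : R) : 0 <= q < 1 ->
  (forall x y, `|f x - f y| <= q * `|x - y|) ->
  exists2 p, f p = p &
    forall x : nat -> X, (forall k, x k.+1 = f (x k)) -> x k @[k --> \oo] --> p.
Proof.
move=> /andP[q0 q1] fq.
have cf : is_contraction ('totalfun_[set: X] f).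
  by exists (NngNum q0); split => //= -[a b] _; exact: fq.
have [p _ fp] : exists2 p, [set: X] p & p = f p.
  by apply: (banach_fixed_point cf); [exact: closedT|exists 0].
exists p => // x xS.
have xp k : `|p - x k| <= geometric `|p - x 0%N| q k.
  elim: k => [|k ih]; first by rewrite /geometric/= expr0 mulr1.
  rewrite xS {1}fp (le_trans (fq _ _))// /geometric/= exprS mulrCA.
  by rewrite ler_wpM2l.
apply/cvgrPdist_le => e e0.
have := @cvg_geometric R `|p - x 0%N| q; rewrite ger0_norm// => /(_ q1).
move=> /cvgrPdist_le/(_ e e0); apply: filterS => k.
rewrite sub0r normrN => H; rewrite (le_trans (xp k))// (le_trans _ H)//.
exact: ler_norm.
Qed.

End contraction_principle.

Section coercive_operators.
Variables (R : realType) (X : hilbertType R).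

(** The damped residual iteration [x - t *: (T x - y)] is a contraction for
    small [t], and its fixed point solves the equation. *)
Lemma lax_milgram (T : {linear X -> X}) (c : R) : continuous T -> 0 < c ->
  (forall x, c * `|x| ^+ 2 <= inner x (T x)) -> forall y, exists x, T x = y.
Proof.
move=> /continuous_linear_le[M0 M00 HM0] c0 coer y.
(* The summand [c] ensures [c <= M], so that the squared factor [q2] is not
   negative. *)
pose M := M0 + c.
have cM : c < M by rewrite /M; lra.
have M_gt0 : 0 < M by rewrite (lt_trans c0).
have HM x : `|T x| <= M * `|x|.
  by rewrite (le_trans (HM0 x))// ler_wpM2r// /M lerDl ltW.
pose t := c / M ^+ 2.
have M2 : 0 < M ^+ 2 by rewrite exprn_gt0.
have t0 : 0 < t by rewrite divr_gt0.
pose q2 := 1 - c ^+ 2 / M ^+ 2.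
have q20 : 0 <= q2.
  rewrite subr_ge0 ler_pdivrMr// mul1r ler_sqr ?nnegrE ?ltW//.
have q21 : q2 < 1 by rewrite gtrBl divr_gt0// exprn_gt0.
have [|x z|p fp _] := @contraction_iterates R X
    (fun x => x - t *: (T x - y)) (Num.sqrt q2).
- by rewrite sqrtr_ge0/= -sqrtr1 ltr_sqrt.
- have -> : x - t *: (T x - y) - (z - t *: (T z - y)) =
      (x - z) - t *: T (x - z) by rewrite (linearB T); vector_ring.
  set d := x - z.
  rewrite -ler_sqr ?nnegrE ?mulr_ge0 ?sqrtr_ge0// exprMn sqr_sqrtr//.
  rewrite sqr_normB innerZr normrZ exprMn (gtr0_norm t0).
  have h1 : t * (c * `|d| ^+ 2) <= t * inner d (T d) by rewrite ler_wpM2l ?coer ?ltW.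
  have h2 : t ^+ 2 * `|T d| ^+ 2 <= t ^+ 2 * (M * `|d|) ^+ 2.
    by rewrite ler_wpM2l ?sqr_ge0// ler_sqr ?nnegrE ?mulr_ge0// ?ltW.
  have -> : q2 * `|d| ^+ 2 =
      `|d| ^+ 2 - 2 * (t * (c * `|d| ^+ 2)) + t ^+ 2 * (M * `|d|) ^+ 2.
    by rewrite /q2 /t; field; rewrite gt_eqF.
  lra.
- exists p; apply/eqP; rewrite -subr_eq0; move/eqP: fp.
  rewrite addrC -subr_eq0 addrK oppr_eq0 scaler_eq0 gt_eqF//=.
Qed.

Lemma coercive_below (T : {linear X -> X}) (c : R) :
  (forall x, c * `|x| ^+ 2 <= inner x (T x)) -> forall x, c * `|x| <= `|T x|.
Proof.
move=> coer x; have [->|x0] := eqVneq x 0; first by rewrite normr0 mulr0.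
have nx : 0 < `|x| by rewrite normr_gt0.
rewrite -(ler_pM2l nx) mulrCA -expr2 (le_trans (coer x))//.
exact: inner_le.
Qed.

Lemma coercive_inverse (T : {linear X -> X}) (c : R) : continuous T -> 0 < c ->
  (forall x, c * `|x| ^+ 2 <= inner x (T x)) ->
  exists S : {linear X -> X}, [/\ continuous S, cancel T S & cancel S T].
Proof.
move=> cT c0 coer; have below := coercive_below coer.
have [S TS] := choice (lax_milgram cT c0 coer).
have Tinj : injective T.
  move=> x y Txy; apply/eqP; rewrite -subr_eq0 -normr_eq0 eq_le normr_ge0 andbT.
  by rewrite -(ler_pM2l c0) mulr0 (le_trans (below _))// linearB/= Txy subrr normr0.
have linS : linear S by move=> a x y; apply: Tinj; rewrite linearP !TS.
pose S' : {linear X -> X} := HB.pack S (GRing.isLinear.Build R X X _ S linS).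
exists S'; split => //; last by move=> x; apply: Tinj; rewrite TS.
apply: (@le_continuous_linear _ _ _ _ c^-1) => x.
by rewrite ler_pdivlMl// -[in leRHS](TS x) below.
Qed.

End coercive_operators.

Section real_spectrum.
Variables (R : realType) (X : hilbertType R) (D : {linear X -> X}).
Hypothesis D_continuous : continuous D.

Definition shift_op (s l : R) : X -> X := fun x => s *: (D x - l *: x).

Lemma shift_op_is_linear s l : linear (shift_op s l).
Proof.
by move=> a x y; rewrite /shift_op linearP; vector_ring.
Qed.

HB.instance Definition _ s l :=
  GRing.isLinear.Build R X X _ (shift_op s l) (shift_op_is_linear s l).

Lemma shift_op_continuous s l : continuous (shift_op s l).
Proof.
move=> x; apply: cvgZr; apply: cvgB; first exact: D_continuous.
by apply: cvgZr.
Qed.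

(** The sign [s] serves both sides of the spectrum: [l - D] is coercive for large
    [l], and [D - l] for small [l]. *)
Lemma coercive_not_spec (s l c : R) : 0 < c ->
  (forall x, c * `|x| ^+ 2 <= s * (inner x (D x) - l * `|x| ^+ 2)) -> ~ spec D l.
Proof.
move=> c0 coer; apply.
have [S [cS TS ST]] : exists S : {linear X -> X},
    [/\ continuous S, cancel (shift_op s l) S & cancel S (shift_op s l)].
  apply: (coercive_inverse (@shift_op_continuous s l) c0) => x.
  by rewrite /shift_op innerZr innerBr innerZr innerxx.
exists (s \*: S); split; last split.
- by move=> x; apply: cvgZr; exact: cS.
- by move=> x /=; rewrite -linearZ; exact: TS.
- by move=> x /=; rewrite -[RHS](ST x) /shift_op [D (s *: _)]linearZ; vector_ring.
Qed.

Lemma not_spec_below l : ~ spec D l ->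
  exists2 c, 0 < c & forall x, c * `|x| <= `|D x - l *: x|.
Proof.
move=> /contrapT[S [/continuous_linear_le[M M0 HM] [SD _]]].
exists M^-1; first by rewrite invr_gt0.
by move=> x; rewrite ler_pdivrMl// -[in leLHS](SD x).
Qed.

Hypothesis D_self_adjoint : self_adjoint D.
Hypothesis D_contractive : opnorm D < 1.
Hypothesis D_posdef : forall x, x != 0 -> 0 < inner x (D x).

(** A positive contraction dominates its square: expand the nonnegative number
    [inner (x - D x) (D (x - D x))]. *)
Lemma sqr_norm_le_form x : `|D x| ^+ 2 <= inner x (D x).
Proof.
have pos y : 0 <= inner y (D y).
  have [->|y0] := eqVneq y 0; first by rewrite inner0l.
  exact/ltW/D_posdef.
have := pos (x - D x); rewrite linearB/= innerBl !innerBr -(D_self_adjoint x (D x)) innerxx.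
have : inner (D x) (D (D x)) <= `|D x| ^+ 2.
  rewrite (le_trans (inner_le _ _))// expr2 ler_wpM2l//.
  rewrite (le_trans (le_opnorm _ D_continuous))//.
  by rewrite -[leRHS]mul1r ler_wpM2r// ltW.
lra.
Qed.

Lemma spec_unit_interval :
  (exists2 c, 0 < c & forall x, c * `|x| <= `|D x|) -> spec D `<=` `]0, 1[.
Proof.
move=> [c c0 below] l Dl /=; rewrite in_itv/= !ltNge; apply/andP; split.
  apply/negP => l0; move: Dl; apply: (@coercive_not_spec 1 l (c ^+ 2)).
    by rewrite exprn_gt0.
  move=> x; rewrite mul1r -exprMn.
  have : (c * `|x|) ^+ 2 <= `|D x| ^+ 2.
    by rewrite ler_sqr ?nnegrE ?mulr_ge0// ltW.
  have := sqr_norm_le_form x; have := sqr_ge0 `|x|; nra.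
apply/negP => l1; move: Dl; apply: (@coercive_not_spec (-1) l (1 - opnorm D)).
  by rewrite subr_gt0.
move=> x.
have h : inner x (D x) <= opnorm D * `|x| ^+ 2.
  rewrite (le_trans (inner_le _ _))// expr2 mulrCA ler_wpM2l//.
  exact: le_opnorm.
have := sqr_ge0 `|x|; nra.
Qed.

End real_spectrum.

(** * Polynomials of a self-adjoint operator *)

(** Divide by the minimal polynomial over the reals of a complex root [a + i b]. *)
Lemma real_poly_factor (R : realType) (p : {poly R}) : (1 < size p)%N ->
  exists a q, p = q * ('X - a%:P) \/
    exists2 b, b != 0 & p = q * (('X - a%:P) ^+ 2 + (b ^+ 2)%:P).
Proof.
move=> p1.
pose j : {rmorphism R -> complex.complex R} := complex.real_complex R.
have [z pz] : exists z, root (map_poly j p) z.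
  by apply/closed_rootP; rewrite size_map_poly gtn_eqF.
case: z pz => a b pz; have [b0|b0] := eqVneq b 0.
  exists a, (p %/ ('X - a%:P)); left; rewrite divpK// dvdp_XsubCl.
  by rewrite -(fmorph_root j); move: pz; rewrite b0.
pose d := ('X - a%:P) ^+ 2 + (b ^+ 2)%:P : {poly R}.
exists a, (p %/ d); right; exists b => //; rewrite -/d.
have jd : (map_poly j d).[complex.Complex a b] = 0.
  rewrite /d rmorphD rmorphXn rmorphB/= map_polyX !map_polyC/= !hornerE/= !expr2.
  by apply/eqP; rewrite eq_complex/=; apply/andP; split; apply/eqP; ring.
have sd : size d = 3.
  rewrite /d size_polyDl size_exp_XsubC// (leq_ltn_trans (size_polyC_leq1 _))//.
have rz : (map_poly j (p %% d)).[complex.Complex a b] = 0.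
  move: pz; rewrite {1}(divp_eq p d) rmorphD rmorphM /root hornerD hornerM jd.
  by rewrite mulr0 add0r => /eqP.
suff r0 : p %% d = 0 by rewrite {1}(divp_eq p d) r0 addr0.
have : (size (p %% d)%R < 3)%N by have := ltn_modp p d; rewrite -size_poly_eq0 sd => ->.
move: (p %% d) rz => r rz; rewrite ltnS => sr.
have rE : r = r`_1 *: 'X + (r`_0)%:P.
  apply/polyP => -[|[|k]]; rewrite !coefE/= ?mulr0 ?mulr1 ?add0r ?addr0//.
  by rewrite nth_default// (leq_trans sr).
have := rz; rewrite rE rmorphD/= map_polyZ map_polyX map_polyC/= !hornerE/=.
move=> /eqP; rewrite eq_complex/= !mul0r subr0 addr0 addr0 => /andP[/eqP h1 /eqP h2].
have {}h2 : r`_1 = 0 by apply/eqP; move/eqP: h2; rewrite mulf_eq0 (negPf b0) orbF.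
by move: h1; rewrite h2 mul0r add0r => ->; rewrite scale0r add0r.
Qed.

Section polynomial_calculus.
Variables (R : realType) (X : hilbertType R) (D : {linear X -> X}).
Implicit Types (p q : {poly R}) (x y : X).

Lemma op_horner_wide n p x : (size p <= n)%N ->
  op_horner D p x = \sum_(i < n) p`_i *: iter i D x.
Proof.
move=> pn; rewrite /op_horner (big_ord_widen n (fun i => p`_i *: iter i D x) pn).
rewrite big_mkcond; apply: eq_bigr => i _; case: ltnP => // pi.
by rewrite nth_default// scale0r.
Qed.

Lemma op_hornerD p q x : op_horner D (p + q) x = op_horner D p x + op_horner D q x.
Proof.
pose n := maxn (size p) (size q).
rewrite !(@op_horner_wide n) ?leq_maxl ?leq_maxr ?size_polyD// -big_split/=.
by apply: eq_bigr => i _; rewrite coefD scalerDl.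
Qed.

Lemma op_hornerZ a p x : op_horner D (a *: p) x = a *: op_horner D p x.
Proof.
rewrite !(@op_horner_wide (size p)) ?size_scale_leq// scaler_sumr.
by apply: eq_bigr => i _; rewrite coefZ scalerA.
Qed.

Lemma op_hornerC a x : op_horner D a%:P x = a *: x.
Proof. by rewrite (@op_horner_wide 1) ?size_polyC_leq1// big_ord1 coefC. Qed.

Lemma op_hornerMX p x : op_horner D (p * 'X) x = D (op_horner D p x).
Proof.
have sp : (size (p * 'X)%R <= (size p).+1)%N.
  by rewrite (leq_trans (size_polyMleq _ _))// size_polyX addn2.
rewrite (op_horner_wide _ sp) big_ord_recl coefMX/= scale0r add0r /op_horner.
by rewrite linear_sum; apply: eq_bigr => i _; rewrite linearZ coefMX.
Qed.

Lemma op_horner_is_linear p : linear (op_horner D p).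
Proof.
move=> a x y; rewrite /op_horner scaler_sumr -big_split/=; apply: eq_bigr => i _.
have -> : iter i D (a *: x + y) = a *: iter i D x + iter i D y.
  by elim: (nat_of_ord i) => //= k ->; rewrite linearP.
by vector_ring.
Qed.

HB.instance Definition _ p :=
  GRing.isLinear.Build R X X _ (op_horner D p) (op_horner_is_linear p).

Lemma op_hornerM p q x : op_horner D (p * q) x = op_horner D p (op_horner D q x).
Proof.
elim/poly_ind: p x => [|p c ih] x.
  by rewrite mul0r -polyC0 !op_hornerC !scale0r.
rewrite mulrDl mul_polyC !op_hornerD op_hornerZ op_hornerC -mulrA -commr_polyX mulrA.
by rewrite !op_hornerMX ih.
Qed.

Lemma op_hornerX x : op_horner D 'X x = D x.
Proof. by rewrite -[X in op_horner D X]mul1r op_hornerMX op_hornerC scale1r. Qed.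

Lemma op_hornerB p q x : op_horner D (p - q) x = op_horner D p x - op_horner D q x.
Proof. by rewrite op_hornerD -scaleN1r op_hornerZ scaleN1r. Qed.

Hypothesis D_continuous : continuous D.

Lemma op_horner_continuous p : continuous (op_horner D p).
Proof.
elim/poly_ind: p => [|p c ih] x.
  have -> : op_horner D 0 = fun=> 0.
    by apply/funext => z; rewrite -polyC0 op_hornerC scale0r.
  exact: cvg_cst.
have -> : op_horner D (p * 'X + c%:P) = fun z => D (op_horner D p z) + c *: z.
  by apply/funext => z; rewrite op_hornerD op_hornerMX op_hornerC.
apply: cvgD; last exact: cvgZr.
exact: cvg_comp (ih x) (@D_continuous (op_horner D p x)).
Qed.

Hypothesis D_self_adjoint : self_adjoint D.

Lemma op_horner_self_adjoint p : self_adjoint (op_horner D p).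
Proof.
elim/poly_ind: p => [|p c ih] x y.
  by rewrite -polyC0 !op_hornerC !scale0r inner0l inner0r.
rewrite !op_hornerD !op_hornerMX !op_hornerC innerDl innerDr innerZl innerZr.
by rewrite D_self_adjoint ih -[D y]op_hornerX -op_hornerM op_hornerMX.
Qed.

Let below (T : X -> X) := exists2 c, 0 < c & forall x, c * `|x| <= `|T x|.

Lemma below_comp T S : below T -> below S -> below (T \o S).
Proof.
move=> [c c0 Tc] [d d0 Sd]; exists (c * d); first exact: mulr_gt0.
by move=> x; rewrite -mulrA; exact: le_trans (ler_wpM2l (ltW c0) (Sd x)) (Tc _).
Qed.

(** Factor [p] over the reals.  A linear factor ['X - a] with [a] outside the
    spectrum is bounded below by definition; an irreducible quadratic one gives
    [(D - a) ^+ 2 + b ^+ 2], which is coercive since [D - a] is symmetric. *)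
Lemma op_horner_below p : p != 0 -> (forall l, spec D l -> p.[l] != 0) ->
  below (op_horner D p).
Proof.
have [n pn] := ubnP (size p); elim: n p pn => // n ih p pn p0 pD.
have [p1|p1] := leqP (size p) 1.
  have := size1_polyC p1; set c := p`_0 => pc.
  have c0 : c != 0 by apply: contraNneq p0 => c0; rewrite pc c0.
  exists `|c|; first by rewrite normr_gt0.
  by move=> x; rewrite pc op_hornerC normrZ.
have step q f : p = q * f -> (1 < size f)%N -> below (op_horner D f) -> below (op_horner D p).
  move=> pqf f1 fb.
  have q0 : q != 0 by apply: contraNneq p0 => q0; rewrite pqf q0 mul0r.
  have f0 : f != 0 by rewrite -size_poly_gt0 (ltn_trans _ f1).
  have -> : op_horner D p = op_horner D q \o op_horner D f.
    by apply/funext => x; rewrite pqf op_hornerM.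
  apply: below_comp fb; apply: ih => //.
    move: pn; rewrite pqf size_mul//; move: (size q) (size f) f1 => a b.
    by case: b => [|[|b]]//= _; rewrite addnS/= addnS ltnS; apply: leq_trans; rewrite ltnS leq_addr.
  by move=> l /pD; rewrite pqf hornerM; apply: contraNneq => ->; rewrite mul0r.
have [a [g [pg|[b b0 pg]]]] := real_poly_factor p1.
  refine (step _ _ pg _ _); first by rewrite size_XsubC.
  have [Da|/not_spec_below[c c0 Hc]] := pselect (spec D a).
    by have := pD _ Da; rewrite pg hornerM hornerXsubC subrr mulr0 eqxx.
  by exists c => // x; rewrite op_hornerB op_hornerX op_hornerC.
refine (step _ _ pg _ _).
  by rewrite size_polyDl size_exp_XsubC// (leq_ltn_trans (size_polyC_leq1 _)).
exists (b ^+ 2); first by rewrite lt_neqAle sqr_ge0 andbT eq_sym sqrf_eq0.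
apply: coercive_below => x /=.
rewrite op_hornerD expr2 op_hornerM op_hornerC innerDr innerZr innerxx.
by rewrite -op_horner_self_adjoint innerxx lerDr sqr_ge0.
Qed.

(** With [M] the norm of [T := p(D)], the operator [M ^+ 2 - T ^+ 2] is not
    bounded below, as testing it on nearly maximizing vectors shows. *)
Lemma op_norm_not_below p (x0 : X) : x0 != 0 ->
  ~ below (op_horner D ((opnorm (op_horner D p) ^+ 2)%:P - p * p)).
Proof.
move=> x00 [c c0 Hc]; pose T := op_horner D p; pose M := opnorm T.
have cT := @op_horner_continuous p.
have TM x : `|T x| <= M * `|x| by exact: le_opnorm.
have nx0 : 0 < `|x0| by rewrite normr_gt0.
have M0 : 0 <= M.
  by rewrite -(pmulr_lge0 _ nx0) (le_trans _ (TM x0)).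
have key x : c ^+ 2 * `|x| ^+ 2 <= M ^+ 2 * (M ^+ 2 * `|x| ^+ 2 - `|T x| ^+ 2).
  rewrite -exprMn (@le_trans _ _ (`|M ^+ 2 *: x - T (T x)| ^+ 2))//.
    rewrite ler_sqr ?nnegrE ?mulr_ge0 ?(ltW c0)// (le_trans (Hc x))//.
    by rewrite op_hornerB op_hornerC op_hornerM.
  rewrite sqr_normB innerZl -(op_horner_self_adjoint p x) innerxx normrZ.
  rewrite (ger0_norm (sqr_ge0 _)).
  have : `|T (T x)| ^+ 2 <= (M * `|T x|) ^+ 2.
    by rewrite ler_sqr ?nnegrE ?mulr_ge0// TM.
  by rewrite /T; nra.
have Mgt0 : 0 < M.
  rewrite lt_neqAle M0 andbT; apply/eqP => M00; have := key x0.
  by rewrite -M00 expr0n mul0r leNgt mulr_gt0 ?exprn_gt0.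
have M20 : 0 < M ^+ 2 by rewrite exprn_gt0.
pose k := Num.max 0 (M ^+ 2 - c ^+ 2 / M ^+ 2).
have k0 : 0 <= k by rewrite le_max lexx.
have Tk x : `|T x| <= Num.sqrt k * `|x|.
  rewrite -ler_sqr ?nnegrE ?mulr_ge0 ?sqrtr_ge0// exprMn sqr_sqrtr//.
  rewrite (@le_trans _ _ ((M ^+ 2 - c ^+ 2 / M ^+ 2) * `|x| ^+ 2))//; last first.
    by rewrite ler_wpM2r ?sqr_ge0// le_max lexx orbT.
  have : c ^+ 2 / M ^+ 2 * `|x| ^+ 2 <= M ^+ 2 * `|x| ^+ 2 - `|T x| ^+ 2.
    by rewrite mulrAC ler_pdivrMr// [leRHS]mulrC key.
  by rewrite mulrBl lerBrDr -lerBrDl.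
have := opnorm_le (sqrtr_ge0 k) Tk; rewrite -/M leNgt => /negP; apply.
rewrite -(ger0_norm M0) -sqrtr_sqr ltr_sqrt// gt_max M20/=.
by rewrite gtrBl divr_gt0// exprn_gt0.
Qed.

(** With ['X] for [p]: on an empty spectrum [op_horner_below] would contradict
    [op_norm_not_below]. *)
Lemma spec_nonempty (x0 : X) : x0 != 0 -> spec D !=set0.
Proof.
move=> x00; apply: contrapT => sD; apply: (op_norm_not_below (p := 'X) x00).
apply: op_horner_below => [|l Dl]; last by case: sD; exists l.
rewrite -size_poly_eq0 -opprB size_polyN -expr2 size_polyDl size_polyXn//.
by rewrite size_polyN (leq_ltn_trans (size_polyC_leq1 _)).
Qed.

(** If the norm [M] of [p(D)] exceeded [e], then [M ^+ 2 - p ^+ 2] would have no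
    zero on the spectrum, and [op_horner_below] would contradict
    [op_norm_not_below]. *)
Lemma op_horner_le p (e : R) x : 0 <= e -> (forall l, spec D l -> `|p.[l]| <= e) ->
  `|op_horner D p x| <= e * `|x|.
Proof.
move=> e0 pe; have [->|x0] := eqVneq x 0; first by rewrite linear0 normr0 mulr0.
have [//|] := leP (opnorm (op_horner D p)) e.
  move=> Me; rewrite (le_trans (le_opnorm x (@op_horner_continuous p)))//.
  by rewrite ler_wpM2r.
set M := opnorm _ => eM; exfalso; apply: (op_norm_not_below (p := p) x0).
have pM l : spec D l -> ((M ^+ 2)%:P - p * p).[l] != 0.
  move=> Dl; rewrite !hornerE subr_eq0 gt_eqF// -expr2 -(real_normK (num_real _)).
  by rewrite ltr_sqr ?nnegrE ?(le_lt_trans (pe _ Dl))// (le_trans e0) ?ltW.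
have [l Dl] := spec_nonempty x0.
apply: op_horner_below => //; rewrite -/M; apply: contraTneq (pM _ Dl) => ->.
by rewrite horner0 eqxx.
Qed.

End polynomial_calculus.

(** * Uniform polynomial approximation on the unit interval *)

Section weierstrass.
Variable R : realType.

(** Near the diagonal uniform continuity gives [e]; away from it the quadratic
    term dominates a bound of [f].  This is the form of continuity that the
    second moment of the Bernstein weights can integrate. *)
Lemma quadratic_modulus (f : R -> R) (e : R) : continuous f -> 0 < e ->
  exists2 K, 0 <= K & forall x y, 0 <= x <= 1 -> 0 <= y <= 1 ->
    `|f x - f y| <= e + K * (x - y) ^+ 2.
Proof.
move=> cf e0.
have [c _ fc] : exists2 c, c \in `[0, 1]%R & forall t, t \in `[0, 1]%R -> `|f t| <= `|f c|.
  apply: (@EVT_max R (fun x => `|f x|)) => //.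
  by apply: continuous_subspaceT => x; apply: cvg_norm; exact: cf.
have [d d0 fd] : exists2 d : R, 0 < d & forall x y, 0 <= x <= 1 -> `|x - y| < d ->
    `|f x - f y| <= e.
  have /compact_near_coveringP := @segment_compact R 0 1.
  move=> /(_ R (0^'+) (fun d x => forall y, `|x - y| < d -> `|f x - f y| <= e)).
  move=> cov; near (0 : R)^'+ => d.
  exists d => //; suff : `[0, 1]%classic `<=`
      (fun x => forall y, `|x - y| < d -> `|f x - f y| <= e).
    by move=> H x y x01; apply: H; rewrite /= in_itv.
  near: d; apply: cov => x _.
  have e20 : 0 < e / 2 by rewrite divr_gt0.
  have /cvgrPdist_lt/(_ _ e20)/nbhs_ballP[r /= r0 fr] := cf x.
  have r20 : 0 < r / 2 by rewrite divr_gt0.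
  exists (ball x (r / 2), [set d | d < r / 2]) => /=.
    by split; [exact: nbhsx_ballx|exact: nbhs_right_lt].
  move=> [z d] /= [xz dr] y zy; move: xz; rewrite -ball_normE /ball_/= => xz.
  have fz : `|f x - f z| < e / 2 by apply: fr; rewrite -ball_normE /ball_/=; lra.
  have fy : `|f x - f y| < e / 2.
    apply: fr; rewrite -ball_normE /ball_/= -(subrKA z).
    by rewrite (le_lt_trans (ler_normD _ _))//; lra.
  rewrite -(subrKA (f x)) (le_trans (ler_normD _ _))// (distrC (f z)); lra.
pose M := `|f c|.
have M2d : 0 <= 2 * M / d ^+ 2.
  by apply: divr_ge0; [apply: mulr_ge0; [exact: ler0n|exact: normr_ge0]|exact: sqr_ge0].
exists (2 * M / d ^+ 2) => //.
move=> x y x01 y01; have [xyd|dxy] := ltP `|x - y| d.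
  rewrite (le_trans (fd _ _ x01 xyd))// lerDl mulr_ge0 ?sqr_ge0//.
rewrite (@le_trans _ _ (2 * M))//.
  by rewrite mulr_natl mulr2n (le_trans (ler_normB _ _))// lerD// fc// in_itv.
have dxy2 : d ^+ 2 <= (x - y) ^+ 2.
  by rewrite -[leRHS]real_normK ?num_real// ler_sqr ?nnegrE// ltW.
rewrite ler_wpDl ?(ltW e0)// mulrAC ler_pdivlMr ?exprn_gt0//.
by apply: ler_wpM2l dxy2; rewrite mulr_ge0 ?ler0n ?normr_ge0.
Unshelve. all: by end_near. Qed.

(** The Bernstein polynomial [\sum_k 'C(n, k) * g k * X^k * (1 - X)^(n - k)],
    presented by conditioning on the first of [n] independent trials. *)
Fixpoint bernstein (n : nat) (g : nat -> R) : {poly R} :=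
  if n is n.+1 then 'X * bernstein n (fun k => g k.+1) + (1 - 'X) * bernstein n g
  else (g 0%N)%:P.

Lemma bernsteinSE n g x : (bernstein n.+1 g).[x] =
  x * (bernstein n (fun k => g k.+1)).[x] + (1 - x) * (bernstein n g).[x].
Proof. by rewrite /= !hornerE. Qed.

Lemma bernstein_monotone n (f g : nat -> R) x : 0 <= x <= 1 ->
  (forall k, (k <= n)%N -> `|f k| <= g k) -> `|(bernstein n f).[x]| <= (bernstein n g).[x].
Proof.
move=> /andP[x0 x1]; elim: n f g => [|n ih] f g fg; first by rewrite /= !hornerC fg.
rewrite !bernsteinSE (le_trans (ler_normD _ _))// !normrM (ger0_norm x0).
rewrite (@ger0_norm _ (1 - x)) ?subr_ge0// lerD// ler_wpM2l ?subr_ge0//; apply: ih => k kn.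
- exact: fg.
- by apply: fg; exact: leqW.
Qed.

Lemma bernstein_affine n (a b : R) (f : nat -> R) x :
  (bernstein n (fun k => a + b * f k)).[x] = a + b * (bernstein n f).[x].
Proof.
elim: n f => [|n ih] f; first by rewrite /= !hornerC.
by rewrite !bernsteinSE !ih; ring.
Qed.

(** The second moment around [d]; the shift [a] lets the induction pass to
    [fun k => g k.+1]. *)
Lemma bernstein_square n (a d : R) x :
  (bernstein n (fun k => (k%:R + a - d) ^+ 2)).[x] =
  (n%:R * x + a - d) ^+ 2 + n%:R * (x * (1 - x)).
Proof.
elim: n a => [|n ih] a; first by rewrite /= hornerC; ring.
rewrite bernsteinSE ih.
under [in bernstein n _]eq_fun do rewrite -natr1 -[_ + 1 + _]addrA.
by rewrite ih -natr1; ring.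
Qed.

(** Integrating the quadratic modulus against the Bernstein weights, of variance
    [x * (1 - x) / n], gives an error of at most [e / 2 + K / n]. *)
Theorem weierstrass (f : R -> R) (e : R) : continuous f -> 0 < e ->
  exists p : {poly R}, forall x, 0 <= x <= 1 -> `|p.[x] - f x| < e.
Proof.
move=> cf e0; have e20 : 0 < e / 2 by rewrite divr_gt0.
have [K K0 fK] := quadratic_modulus cf e20.
have Ke : 0 <= K / (e / 2) by rewrite divr_ge0// ltW.
pose n := Num.bound (K / (e / 2)).
have nKe : K / (e / 2) < n%:R by exact: archi_boundP.
have n0 : 0 < n%:R :> R by exact: le_lt_trans nKe.
have nK : K / n%:R < e / 2 by rewrite ltr_pdivrMr// mulrC -ltr_pdivrMr.
exists (bernstein n (fun k => f (k%:R / n%:R))) => x x01.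
have -> : (bernstein n (fun k => f (k%:R / n%:R))).[x] - f x =
    (bernstein n (fun k => - f x + 1 * f (k%:R / n%:R))).[x].
  by rewrite bernstein_affine mul1r addrC.
apply: (@le_lt_trans _ _ (bernstein n (fun k =>
    e / 2 + K / n%:R ^+ 2 * (k%:R + 0 - n%:R * x) ^+ 2)).[x]).
  apply: bernstein_monotone => // k kn; rewrite mul1r addrC.
  have -> : K / n%:R ^+ 2 * (k%:R + 0 - n%:R * x) ^+ 2 = K * (k%:R / n%:R - x) ^+ 2.
    by field; rewrite gt_eqF.
  by apply: fK => //; rewrite divr_ge0//= ler_pdivrMr// mul1r ler_nat.
rewrite bernstein_affine bernstein_square.
have -> : e / 2 + K / n%:R ^+ 2 *
    ((n%:R * x + 0 - n%:R * x) ^+ 2 + n%:R * (x * (1 - x))) =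
    e / 2 + K / n%:R * (x * (1 - x)) by field; rewrite gt_eqF.
have : K / n%:R * (x * (1 - x)) <= K / n%:R.
  by rewrite ler_piMr ?divr_ge0//; nra.
lra.
Qed.

End weierstrass.

(** * Continuous functional calculus *)

Section functional_calculus.
Variables (R : realType) (X : hilbertType R) (D : {linear X -> X}).
Hypotheses (D_continuous : continuous D) (D_self_adjoint : self_adjoint D).
Implicit Types (f g : R -> R) (p q : {poly R}) (x y : X).

(** The functions for which the filter defining [cfc] is proper.  Closeness to
    polynomials, rather than continuity, is inherited by the uniform limit
    [rstar], of which only the values on the spectrum are known. *)
Definition approximable (S : set R) f :=
  forall e, 0 < e -> exists p, forall l, S l -> `|p.[l] - f l| < e.

Lemma continuous_approximable f g : spec D `<=` `]0, 1[ -> continuous f ->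
  (forall l, spec D l -> g l = f l) -> approximable (spec D) g.
Proof.
move=> D01 cf gf e e0; have [p pf] := weierstrass cf e0.
exists p => l Dl; rewrite gf// pf//.
by have := D01 _ Dl; rewrite /= in_itv/= => /andP[l0 l1]; rewrite !ltW.
Qed.

Lemma poly_approx_proper f : approximable (spec D) f -> ProperFilter (poly_approx (spec D) f).
Proof.
move=> af; apply: filter_from_proper; last by move=> e /= /af.
apply: filter_from_filter; first by exists 1 => /=.
move=> a b /= a0 b0; exists (Num.min a b); first by rewrite /= lt_min a0.
by move=> p pf; split => l Dl; have := pf _ Dl; rewrite lt_min => /andP[].
Qed.

Lemma op_horner_dist p q (e : R) x : 0 <= e ->
  (forall l, spec D l -> `|p.[l] - q.[l]| <= e) ->
  `|op_horner D p x - op_horner D q x| <= e * `|x|.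
Proof.
move=> e0 pq; rewrite -op_hornerB; apply: op_horner_le => // l Dl.
by rewrite hornerD hornerN pq.
Qed.

Lemma cfc_cvg f x : approximable (spec D) f ->
  op_horner D p x @[p --> poly_approx (spec D) f] --> cfc D f x.
Proof.
move=> af; have FF := poly_approx_proper af.
suff : cvg (op_horner D p x @[p --> poly_approx (spec D) f]) by [].
apply/cauchy_cvgP; apply: cauchy_exP => e e0.
have x1 : 0 < `|x| + 1 by rewrite ltr_wpDl.
pose d := e / (`|x| + 1) / 2.
have d0 : 0 < d by rewrite !divr_gt0.
have [p pf] := af _ d0; exists (op_horner D p x), d => // q qf.
rewrite /= -ball_normE /ball_/=.
apply: (@le_lt_trans _ _ (2 * d * `|x|)); last first.
  rewrite /d mulrC [2 * _]mulrC divfK ?pnatr_eq0// mulrA ltr_pdivrMr// mulrC.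
  by rewrite ltr_pM2l// ltrDl.
apply: op_horner_dist => [|l Dl]; first by rewrite mulr_ge0// ltW.
rewrite -(subrKA (f l)) (le_trans (ler_normD _ _))// [`|f l - _|]distrC.
by have := pf _ Dl; have := qf _ Dl; lra.
Qed.

(** The limit of [op_horner_dist] along polynomials approximating [f]. *)
Lemma cfc_dist f p (e : R) x : approximable (spec D) f -> 0 <= e ->
  (forall l, spec D l -> `|p.[l] - f l| <= e) ->
  `|op_horner D p x - cfc D f x| <= e * `|x|.
Proof.
move=> af e0 pf; have FF := poly_approx_proper af.
apply/ler_addgt0Pr => d d0.
have x1 : 0 < `|x| + 1 by rewrite ltr_wpDl.
pose c := d / (2 * (`|x| + 1)).
have c0 : 0 < c by rewrite divr_gt0// mulr_gt0.
have /cvgrPdist_lt/(_ _ (divr_gt0 d0 (ltr0Sn R 1))) [c1 /= c10 Hc1] := @cfc_cvg f x af.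
have c2 : 0 < Num.min c c1 by rewrite lt_min c0.
have [q qf] := af _ c2.
have h1 : `|cfc D f x - op_horner D q x| < d / 2.
  by apply: Hc1 => l Dl; have := qf _ Dl; rewrite lt_min => /andP[].
have h2 : `|op_horner D p x - op_horner D q x| <= (e + c) * `|x|.
  apply: op_horner_dist => [|l Dl]; first by rewrite addr_ge0// ltW.
  rewrite -(subrKA (f l)) (le_trans (ler_normD _ _))// [`|f l - _|]distrC.
  by rewrite lerD ?pf// ltW//; have := qf _ Dl; rewrite lt_min => /andP[].
rewrite -(subrKA (op_horner D q x)) (le_trans (ler_normD _ _))//.
rewrite [`|op_horner D q x - _|]distrC.
have h3 : c * `|x| <= d / 2.
  have dE : d = c * (2 * (`|x| + 1)) by rewrite /c divfK// gt_eqF// mulr_gt0.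
  by rewrite dE !mulrDr mulr1; lra.
by move: h1 h2 h3; rewrite mulrDl; lra.
Qed.

(** Identification of [cfc D f x]; the approximability of [f] is part of the
    hypothesis. *)
Lemma cfc_eq f x v (C : R) :
  (forall e, 0 < e -> exists p, (forall l, spec D l -> `|p.[l] - f l| < e) /\
     `|op_horner D p x - v| <= C * e) ->
  cfc D f x = v.
Proof.
move=> H.
have af : approximable (spec D) f.
  by move=> e /H[p [pf _]]; exists p.
apply/eqP; rewrite -subr_eq0 -normr_eq0 eq_le normr_ge0 andbT.
apply/ler_addgt0Pl => d d0; rewrite addr0.
have C1 : 0 < `|x| + `|C| + 1 by rewrite ltr_wpDl// addr_ge0.
have e0 : 0 < d / (`|x| + `|C| + 1) by rewrite divr_gt0.
set e := d / _ in e0; have [p [pf pv]] := H _ e0.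
have h : `|op_horner D p x - cfc D f x| <= e * `|x|.
  by apply: cfc_dist => // [|l Dl]; rewrite ltW// pf.
have : d = e * (`|x| + `|C| + 1) by rewrite /e divfK// gt_eqF.
have : C * e <= `|C| * e by rewrite ler_wpM2r ?(ltW e0)// ler_norm.
rewrite -(subrKA (op_horner D p x)) => h1 h2.
rewrite (le_trans (ler_normD _ _))// [`|cfc D f x - _|]distrC h2.
rewrite !mulrDr; lra.
Qed.

Lemma cfc_is_linear f : approximable (spec D) f -> linear (cfc D f).
Proof.
move=> af a x y; apply: (@cfc_eq _ _ _ (`|a| * `|x| + `|y|)) => e e0.
have [p pf] := af _ e0; exists p; split => //; rewrite (linearP (op_horner D p)).
have D0 z : `|op_horner D p z - cfc D f z| <= e * `|z|.
  by apply: cfc_dist => // [|l Dl]; rewrite ltW// pf.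
set u := op_horner D p x; set v := op_horner D p y.
have -> : a *: u + v - (a *: cfc D f x + cfc D f y) =
   a *: (u - cfc D f x) + (v - cfc D f y) by vector_ring.
rewrite (le_trans (ler_normD _ _))// normrZ mulrDl lerD//; last by rewrite mulrC D0.
by rewrite mulrAC -mulrA ler_wpM2l// D0.
Qed.

Lemma cfc_affine f (a b : R) x : approximable (spec D) f ->
  cfc D (fun l => a + b * f l) x = a *: x + b *: cfc D f x.
Proof.
move=> af; apply: (@cfc_eq _ _ _ `|x|) => e e0.
have b1 : 0 < `|b| + 1 by rewrite ltr_wpDl.
have d0 : 0 < e / (`|b| + 1) by rewrite divr_gt0.
have [p pf] := af _ d0; exists (a%:P + b *: p).
have bd : `|b| * (e / (`|b| + 1)) < e.
  by rewrite mulrA ltr_pdivrMr// mulrC ltr_pM2l// ltrDl.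
split => [l Dl|].
  have -> : (a%:P + b *: p).[l] - (a + b * f l) = b * (p.[l] - f l).
    by rewrite !hornerE; ring.
  by rewrite normrM (le_lt_trans _ bd)// ler_wpM2l// ltW// pf.
rewrite op_hornerD op_hornerC op_hornerZ.
set u := op_horner D p x.
have -> : a *: x + b *: u - (a *: x + b *: cfc D f x) = b *: (u - cfc D f x).
  by vector_ring.
rewrite normrZ.
have h : `|u - cfc D f x| <= e / (`|b| + 1) * `|x|.
  by apply: cfc_dist => // [|l Dl]; rewrite ltW// pf.
rewrite (le_trans (ler_wpM2l _ h))// mulrA [leRHS]mulrC ler_wpM2r// ltW//.
Qed.

Lemma cfc_close f g (e : R) x : approximable (spec D) f -> approximable (spec D) g ->
  0 <= e -> (forall l, spec D l -> `|f l - g l| <= e) ->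
  `|cfc D f x - cfc D g x| <= e * `|x|.
Proof.
move=> af ag e0 fg; apply/ler_addgt0Pr => d d0.
have x1 : 0 < 2 * (`|x| + 1) by rewrite mulr_gt0// ltr_wpDl.
pose c := d / (2 * (`|x| + 1)).
have c0 : 0 < c by rewrite divr_gt0.
have [p pf] := af _ c0.
have h1 : `|op_horner D p x - cfc D f x| <= c * `|x|.
  by apply: cfc_dist => // [|l Dl]; rewrite ltW// pf.
have h2 : `|op_horner D p x - cfc D g x| <= (c + e) * `|x|.
  apply: cfc_dist => // [|l Dl]; first by rewrite addr_ge0// ltW.
  by rewrite -(subrKA (f l)) (le_trans (ler_normD _ _))// lerD ?fg// ltW// pf.
have dE : d = 2 * (c * `|x|) + 2 * c.
  by rewrite -[LHS](divfK (lt0r_neq0 x1)) -/c; ring.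
rewrite -(subrKA (op_horner D p x)) (le_trans (ler_normD _ _))//.
rewrite [`|cfc D f x - _|]distrC.
by move: h2; rewrite mulrDl; lra.
Qed.

Lemma cfc_le f (M : R) x : approximable (spec D) f -> 0 <= M ->
  (forall l, spec D l -> `|f l| <= M) -> `|cfc D f x| <= M * `|x|.
Proof.
move=> af M0 fM; have : `|op_horner D 0 x - cfc D f x| <= M * `|x|.
  by apply: cfc_dist => // l Dl; rewrite horner0 sub0r normrN fM.
by rewrite -polyC0 op_hornerC scale0r sub0r normrN.
Qed.

Lemma cfcM f g (M : R) x : approximable (spec D) f -> approximable (spec D) g ->
  (forall l, spec D l -> `|f l| <= M) -> (forall l, spec D l -> `|g l| <= M) ->
  cfc D (fun l => f l * g l) x = cfc D f (cfc D g x).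
Proof.
move=> af ag fM gM.
pose N := `|M| + 1.
have N0 : 0 < N by rewrite ltr_wpDl.
have fN l : spec D l -> `|f l| <= N.
  by move=> Dl; rewrite (le_trans (fM _ Dl))// (le_trans (ler_norm _))// lerDl.
have gN l : spec D l -> `|g l| <= N.
  by move=> Dl; rewrite (le_trans (gM _ Dl))// (le_trans (ler_norm _))// lerDl.
apply: (@cfc_eq _ _ _ `|x|) => e e0.
(* The error of the product is at most [d ^+ 2 + 2 * N * d]. *)
pose d := Num.min 1 (e / (2 * N + 2)).
have N2 : 0 < 2 * N + 2 by lra.
have d0 : 0 < d by rewrite lt_min ltr01 divr_gt0.
have d1 : d <= 1 by rewrite ge_min lexx.
have de : d * (2 * N + 2) <= e.
  by rewrite -ler_pdivlMr// ge_min lexx orbT.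
have [p pf] := af _ d0; have [q qf] := ag _ d0; exists (p * q); split => [l Dl|].
  rewrite hornerM.
  have -> : p.[l] * q.[l] - f l * g l =
    (p.[l] - f l) * (q.[l] - g l) + (f l * (q.[l] - g l) + g l * (p.[l] - f l)) by ring.
  have h1 := pf _ Dl; have h2 := qf _ Dl; have h3 := fN _ Dl; have h4 := gN _ Dl.
  have k1 : `|p.[l] - f l| * `|q.[l] - g l| <= 1 * d.
    by rewrite ler_pM// ltW// (lt_le_trans h1).
  have k2 : `|f l| * `|q.[l] - g l| <= N * d by rewrite ler_pM// ltW.
  have k3 : `|g l| * `|p.[l] - f l| <= N * d by rewrite ler_pM// ltW.
  rewrite (le_lt_trans (ler_normD _ _))// normrM.
  rewrite (le_lt_trans (lerD k1 (ler_normD _ _)))// !normrM.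
  lra.
rewrite op_hornerM -(subrKA (op_horner D p (cfc D g x))) -(linearB (op_horner D p)).
have p1 l : spec D l -> `|p.[l]| <= N + 1.
  move=> Dl; rewrite -(subrK (f l) p.[l]) (le_trans (ler_normD _ _))// addrC.
  by rewrite lerD ?fN// ltW// (lt_le_trans (pf _ Dl)).
rewrite (le_trans (ler_normD _ _))//.
have j1 : `|op_horner D p (op_horner D q x - cfc D g x)| <= (N + 1) * (d * `|x|).
  rewrite (le_trans (op_horner_le D_continuous D_self_adjoint _ _ p1))//; first lra.
  rewrite ler_wpM2l//; first lra.
  by apply: cfc_dist => // [|l Dl]; rewrite ltW// qf.
have j2 : `|op_horner D p (cfc D g x) - cfc D f (cfc D g x)| <= d * (N * `|x|).
  rewrite (@le_trans _ _ (d * `|cfc D g x|))//.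
    by apply: cfc_dist => // [|l Dl]; rewrite ltW// pf.
  by rewrite ler_wpM2l ?(ltW d0)// cfc_le// ltW.
have : `|x| * (d * (2 * N + 2)) <= `|x| * e by rewrite ler_wpM2l.
have := mulr_ge0 (ltW d0) (normr_ge0 x); nra.
Qed.

Lemma cfc_inverse f g (M : R) : approximable (spec D) f -> approximable (spec D) g ->
  (forall l, spec D l -> `|f l| <= M) -> (forall l, spec D l -> `|g l| <= M) ->
  (forall l, spec D l -> f l * g l = 1) ->
  [/\ cancel (cfc D f) (cfc D g), cancel (cfc D g) (cfc D f) &
      op_inv (cfc D f) = cfc D g].
Proof.
move=> af ag fM gM fg.
have cfc1 k x : (forall l, spec D l -> k l = 1) -> cfc D k x = x.
  move=> k1; apply: (@cfc_eq _ _ _ 0) => e e0; exists 1%:P; split => [l Dl|].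
    by rewrite hornerC k1// subrr normr0.
  by rewrite op_hornerC scale1r subrr normr0 mul0r.
have fgK : cancel (cfc D f) (cfc D g).
  by move=> x; rewrite -(cfcM _ ag af gM fM) cfc1// => l Dl; rewrite mulrC fg.
have gfK : cancel (cfc D g) (cfc D f).
  by move=> x; rewrite -(cfcM _ af ag fM gM) cfc1.
split => //; apply/funext => y; rewrite /op_inv.
by case: xgetP => [z _ /= <-|/(_ (cfc D g y))/=]; rewrite ?fgK// gfK.
Qed.

Lemma cfc_self_adjoint f : approximable (spec D) f -> self_adjoint (cfc D f).
Proof.
move=> af x y; have FF := poly_approx_proper af.
have h1 : inner (op_horner D p x) y @[p --> poly_approx (spec D) f] --> inner (cfc D f x) y.
  by apply: inner_cvg; [exact: cfc_cvg|exact: cvg_cst].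
have h2 : inner x (op_horner D p y) @[p --> poly_approx (spec D) f] --> inner x (cfc D f y).
  by apply: inner_cvg; [exact: cvg_cst|exact: cfc_cvg].
have E : (fun p => inner (op_horner D p x) y) = (fun p => inner x (op_horner D p y)).
  by apply/funext => p; rewrite op_horner_self_adjoint.
by move: h1; rewrite E => h1; exact: cvg_unique h1 h2.
Qed.

(** Compare [f] with the midpoint of its range. *)
Lemma cfc_form_ge f (m M : R) x : approximable (spec D) f -> m <= M ->
  (forall l, spec D l -> m <= f l <= M) -> m * `|x| ^+ 2 <= inner x (cfc D f x).
Proof.
move=> af mM fm.
have : `|op_horner D ((M + m) / 2)%:P x - cfc D f x| <= (M - m) / 2 * `|x|.
  apply: cfc_dist => // [|l Dl]; first lra.
  rewrite hornerC ler_norml; have /andP[] := fm _ Dl; lra.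
rewrite op_hornerC => h.
have : inner x ((M + m) / 2 *: x - cfc D f x) <= `|x| * ((M - m) / 2 * `|x|).
  by rewrite (le_trans (inner_le _ _))// ler_wpM2l.
rewrite innerBr innerZr innerxx; nra.
Qed.

End functional_calculus.

(** * Tikhonov functionals *)

Section tikhonov.
Variables (R : realType) (X Y : hilbertType R) (A : {linear X -> Y}).
Hypotheses (A_continuous : continuous A) (A_norm : opnorm A = 1).

Lemma opnorm1_le x : `|A x| <= `|x|.
Proof. by rewrite -[leRHS]mul1r -A_norm le_opnorm. Qed.

(** Since [`|adjoint A (A x)| <= `|A x|], the square of the left-hand side is at
    most [`|x| ^+ 2 - `|A x| ^+ 2]. *)
Lemma gradient_step_le x : `|x - adjoint A (A x)| <= `|x|.
Proof.
rewrite -ler_sqr ?nnegrE// sqr_normB -adjointE// innerxx.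
have : `|adjoint A (A x)| ^+ 2 <= `|A x| ^+ 2.
  rewrite ler_sqr ?nnegrE// -[leRHS]mul1r; apply: adjoint_le => // z.
  by rewrite mul1r opnorm1_le.
have := sqr_ge0 `|A x|; lra.
Qed.

Variables (S : {linear X -> X}) (c : R).
Hypotheses (S_self_adjoint : self_adjoint S) (c_gt0 : 0 < c)
  (S_coercive : forall x, c * `|x| ^+ 2 <= inner x (S x)).

Lemma form_shift x d (t : R) :
  inner (x + t *: d) (S (x + t *: d)) =
  inner x (S x) + 2 * t * inner d (S x) + t ^+ 2 * inner d (S d).
Proof.
rewrite linearD [S (t *: _)]linearZ/= innerDl !innerDr !innerZl !innerZr.
rewrite -(S_self_adjoint x d) (innerC (S x)); ring.
Qed.

Lemma form_continuous : continuous S -> continuous (fun x => inner x (S x)).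
Proof. by move=> cS x; apply: inner_cvg; [exact: cvg_id|exact: cS]. Qed.

(** The normal equation cancels the first order terms of [F] at [p], so that [F z]
    exceeds [F p] by a positive definite form in [z - p]. *)
Lemma tikhonov_argmin (tau : R) y p (F : X -> R) : 0 < tau ->
  (forall x, F x = 2^-1 * `|A x - y| ^+ 2 + tau / 2 * inner x (S x)) ->
  adjoint A (A p - y) + tau *: S p = 0 -> argmin setT F = [set p].
Proof.
move=> tau0 FE normal.
have gap z : F z = F p + 2^-1 * `|A (z - p)| ^+ 2 + tau / 2 * inner (z - p) (S (z - p)).
  have := form_shift p (z - p) 1; rewrite scale1r subrKC !FE => ->.
  have -> : A z - y = (A p - y) + A (z - p) by rewrite linearB; vector_ring.
  set d := z - p.
  rewrite sqr_normD innerC adjointE//.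
  have : inner d (adjoint A (A p - y)) = - (tau * inner d (S p)).
    by apply/eqP; rewrite -addr_eq0 -innerZr -innerDr normal inner0r.
  by move=> ->; field.
have gap0 z : F p + tau / 2 * (c * `|z - p| ^+ 2) <= F z.
  rewrite (gap z) -addrA lerD2l ler_wpDl ?mulr_ge0 ?invr_ge0 ?sqr_ge0//.
  by rewrite ler_wpM2l ?S_coercive// divr_ge0// ltW.
apply/seteqP; split => [z [_ /(_ p I) Fz] /=|_ -> /=]; last first.
  split => // z _; rewrite (le_trans _ (gap0 z))// lerDl.
  by rewrite !mulr_ge0 ?sqr_ge0 ?invr_ge0// ltW.
have : tau / 2 * (c * `|z - p| ^+ 2) <= 0 by have := gap0 z; lra.
rewrite pmulr_rle0 ?divr_gt0// pmulr_rle0// => H.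
have : `|z - p| ^+ 2 == 0 by rewrite eq_le H sqr_ge0.
by rewrite sqrf_eq0 normr_eq0 subr_eq0 => /eqP.
Qed.

Hypothesis S_continuous : continuous S.

Lemma least_squares_solutions xs :
  [set x | adjoint A (A x - A xs) = 0] = [set x | A x = A xs].
Proof.
apply/seteqP; split => x /=.
  by rewrite -linearB => /(adjoint_range_eq0 A_continuous _).1; rewrite linearB => /subr0_eq.
by move=> ->; rewrite subrr adjoint0.
Qed.

(** Varying the minimizer [xd] along the kernel of [A] shows that [S xd] is
    orthogonal to it, which makes it a limit of vectors [adjoint A w]. *)
Lemma minimal_solution xs (F : X -> R) : (forall x, F x = 2^-1 * inner x (S x)) ->
  exists2 xd, argmin [set x | adjoint A (A x - A xs) = 0] F = [set xd] &
    A xd = A xs /\ forall e, 0 < e -> exists w, `|S xd - adjoint A w| < e.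
Proof.
move=> FE; rewrite least_squares_solutions.
have [|||||||x Ex] := @energy_argmin R X [set x | A x = A xs] F (c / 2).
- rewrite (_ : mkset _ = (fun x => `|A x - A xs|) @^-1` [set r | r = 0]).
    apply: preimage_closed; last exact: closed_eq.
    move=> x _; apply: cvg_norm; apply: cvgB; last exact: cvg_cst.
    exact: A_continuous.
  apply/seteqP; split => x /=; first by move=> ->; rewrite subrr normr0.
  by move=> /normr0_eq0/subr0_eq.
- by exists xs.
- move=> x y /= Ax Ay; rewrite linearZ/= linearD Ax Ay; vector_ring.
- by rewrite divr_gt0.
- by move=> x; rewrite FE mulrAC mulrC ler_wpM2l ?invr_ge0// mulrC.
- rewrite (_ : F = fun x => 2^-1 * inner x (S x)); last exact/funext.
  by move=> x; apply: cvgMr; exact: form_continuous.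
- move=> x y; rewrite !FE.
  rewrite [S (2^-1 *: _)]linearZ/= (linearB S) (linearD S) innerZl innerZr innerBl innerDl.
  by rewrite !innerBr !innerDr -(S_self_adjoint x y) (innerC (S x)); field.
have [Ax xmin] : argmin [set x | A x = A xs] F x by rewrite Ex.
exists x => //; split => //; apply: orth_ker_adjoint => // d Ad.
apply: (@linear_coef_eq0 _ (inner d (S d))) => t.
have : F x <= F (x + t *: d).
  by apply: xmin; rewrite /= linearD linearZ/= Ad scaler0 addr0.
rewrite !FE form_shift (innerC (S x)); lra.
Qed.

(** Error estimate for an approximate form [T]: the minimality of [x] controls
    [inner x (S x) - inner xd (S xd)], and the cross term [inner (x - xd) (S xd)]
    is controlled by the residual as far as [S xd] is in the range of
    [adjoint A]. *)
Lemma tikhonov_error (T : X -> X) (e tau delta : R) x xd w yd :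
  0 < tau -> (forall z, `|T z - S z| <= e * `|z|) -> `|yd - A xd| <= delta ->
  2^-1 * `|A x - yd| ^+ 2 + tau / 2 * inner x (T x) <=
    2^-1 * `|A xd - yd| ^+ 2 + tau / 2 * inner xd (T xd) ->
  c * `|x - xd| ^+ 2 <= delta ^+ 2 / tau + e * (`|x| ^+ 2 + `|xd| ^+ 2) +
    2 * (`|A x - A xd| * `|w| + `|x - xd| * `|S xd - adjoint A w|).
Proof.
move=> tau0 TS ydelta minx.
have TSform z : `|inner z (T z) - inner z (S z)| <= e * `|z| ^+ 2.
  rewrite -innerBr (le_trans (abs_inner_le _ _))// expr2 mulrCA ler_wpM2l//.
have d2 : `|A xd - yd| ^+ 2 <= delta ^+ 2.
  by rewrite distrC ler_sqr ?nnegrE// (le_trans _ ydelta).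
have h1 : inner x (T x) <= delta ^+ 2 / tau + inner xd (T xd).
  rewrite -lerBlDr ler_pdivlMr//; have := sqr_ge0 `|A x - yd|; nra.
have := TSform x; have := TSform xd; rewrite !ler_norml => /andP[a1 a2] /andP[b1 b2].
have cross : - inner (x - xd) (S xd) <=
    `|A x - A xd| * `|w| + `|x - xd| * `|S xd - adjoint A w|.
  have -> : - inner (x - xd) (S xd) =
      inner (A x - A xd) (- w) + inner (x - xd) (- (S xd - adjoint A w)).
    by rewrite -linearB !innerNr adjointE// innerBr; ring.
  by rewrite lerD// (le_trans (inner_le _ _))// normrN.
have := form_shift xd (x - xd) 1.
rewrite scale1r subrKC; have := S_coercive (x - xd); lra.
Qed.

End tikhonov.

(** * The operators of the family h *)

Section resolvent_family.
Variables (R : realType) (X : hilbertType R) (D : {linear X -> X}) (h : R -> R -> R).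

Lemma r_values_bounds : (0 < ereal_inf (EFin @` r_values D h))%E ->
  (ereal_sup (EFin @` r_values D h) < +oo)%E ->
  exists c C : R, [/\ 0 < c, c <= C &
    forall tau l, 0 < tau -> spec D l -> c <= r_fun h tau l <= C].
Proof.
move=> inf0 supy.
have [c c0 Hc] : exists2 c : R, 0 < c & forall z, r_values D h z -> c <= z.
  have Hinf z : r_values D h z -> (ereal_inf (EFin @` r_values D h) <= z%:E)%E.
    by move=> rz; apply: ereal_inf_lbound; exists z.
  case: (ereal_inf _) inf0 Hinf => [c c0 Hc|_ Hc|//].
    by exists c => // z /Hc; rewrite lee_fin.
  by exists 1 => // z /Hc; rewrite leNgt ltry.
have [C HC] : exists C : R, forall z, r_values D h z -> z <= C.
  have Hsup z : r_values D h z -> (z%:E <= ereal_sup (EFin @` r_values D h))%E.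
    by move=> rz; apply: ereal_sup_ubound; exists z.
  case: (ereal_sup _) supy Hsup => [C _ HC|//|_ HC].
    by exists C => z /HC; rewrite lee_fin.
  by exists 1 => z /HC; rewrite leNgt ltNyr.
exists c, (Num.max c C); split => //; first by rewrite le_max lexx.
move=> tau l tau0 Dl; have rv : r_values D h (r_fun h tau l) by exists tau, l.
by rewrite Hc//= le_max HC ?orbT.
Qed.

Hypotheses (D_continuous : continuous D) (D_self_adjoint : self_adjoint D).
Hypothesis D01 : spec D `<=` `]0, 1[.
Hypothesis h_cont : forall tau, 0 < tau -> continuous (h tau).
Hypothesis h01 : forall tau l, 0 < tau -> spec D l -> 0 < h tau l < 1.
Variables c C : R.
Hypotheses (c_gt0 : 0 < c) (cC : c <= C)
  (r_bounds : forall tau l, 0 < tau -> spec D l -> c <= r_fun h tau l <= C).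

Let S tau := cfc D (r_fun h tau).

Lemma h_resolvent tau l : 0 < tau -> spec D l -> h tau l * (1 + tau * r_fun h tau l) = 1.
Proof.
move=> tau0 Dl; have /andP[h0 _] := h01 tau0 Dl.
by rewrite /r_fun; field; rewrite !gt_eqF.
Qed.

Let C_ge0 : 0 <= C.
Proof. by rewrite ltW// (lt_le_trans c_gt0). Qed.

Lemma h_bounds tau l : 0 < tau -> spec D l -> (1 + tau * C)^-1 <= h tau l <= (1 + tau * c)^-1.
Proof.
move=> tau0 Dl; have /andP[rc rC] := r_bounds tau0 Dl.
have pos a : 0 <= a -> 0 < 1 + tau * a.
  by move=> a0; rewrite ltr_wpDr// mulr_ge0// ltW.
have r0 : 0 <= r_fun h tau l by rewrite (le_trans _ rc)// ltW.
have -> : h tau l = (1 + tau * r_fun h tau l)^-1.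
  by rewrite -[LHS](mulfK (lt0r_neq0 (pos _ r0))) h_resolvent// mul1r.
by rewrite !lef_pV2 ?posrE ?pos ?(ltW c_gt0)// !lerD2l !ler_pM2l// rC rc.
Qed.

Lemma h_approximable tau : 0 < tau -> approximable (spec D) (h tau).
Proof. by move=> tau0; apply: (continuous_approximable D01 (h_cont tau0)). Qed.

(** Off the spectrum [h tau] may vanish, so [r_fun h tau] need not be continuous;
    truncating the denominator from below gives a continuous function that
    agrees with it on the spectrum. *)
Lemma r_approximable tau : 0 < tau -> approximable (spec D) (r_fun h tau).
Proof.
move=> tau0; pose m := (1 + tau * C)^-1.
have m0 : 0 < m by rewrite invr_gt0 ltr_wpDr// mulr_ge0// ltW.
apply: (@continuous_approximable _ _ _ (fun l => (1 - h tau l) / (tau * Num.max (h tau l) m))).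
- by [].
- have ch := h_cont tau0; move=> l; apply: cvgM.
    by apply: cvgB; [exact: cvg_cst|exact: ch].
  apply: cvgV; first by rewrite mulf_neq0 ?gt_eqF// lt_max m0 orbT.
  apply: cvgMr.
  exact: (@continuous_max R R (h tau) (fun=> m) l (ch l) (cvg_cst _)).
- move=> l Dl; have /andP[mh _] := h_bounds tau0 Dl.
  by rewrite /r_fun (max_l mh).
Qed.

Lemma cfc_r_linear tau : 0 < tau -> linear (S tau).
Proof. by move=> tau0; apply: cfc_is_linear => //; exact: r_approximable. Qed.

Lemma cfc_r_form_ge tau x : 0 < tau -> c * `|x| ^+ 2 <= inner x (S tau x).
Proof.
move=> tau0; apply: (@cfc_form_ge _ _ _ _ _ _ _ C) => //; first exact: r_approximable.
by move=> l Dl; exact: r_bounds.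
Qed.

Lemma cfc_r_le tau x : 0 < tau -> `|S tau x| <= C * `|x|.
Proof.
move=> tau0; apply: cfc_le => //; first exact: r_approximable.
move=> l Dl; have /andP[rc rC] := r_bounds tau0 Dl.
by rewrite ger0_norm// (le_trans _ rc)// ltW.
Qed.

Lemma cfc_h_inverse tau : 0 < tau ->
  [/\ cancel (cfc D (h tau)) (fun x => x + tau *: S tau x),
      cancel (fun x => x + tau *: S tau x) (cfc D (h tau)) &
      op_inv (cfc D (h tau)) = (fun x => x + tau *: S tau x)].
Proof.
move=> tau0; pose g l := 1 + tau * r_fun h tau l.
have ar := r_approximable tau0.
have gE : cfc D g = (fun x => x + tau *: S tau x).
  by apply/funext => x; rewrite cfc_affine// scale1r.
rewrite -gE; apply: (@cfc_inverse _ _ _ _ _ _ _ (1 + tau * C)) => //.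
- exact: h_approximable.
- move=> e e0; have t1 : 0 < e / tau by rewrite divr_gt0.
  have [p pf] := ar _ t1; exists (1%:P + tau *: p) => l Dl.
  have -> : (1%:P + tau *: p).[l] - g l = tau * (p.[l] - r_fun h tau l).
    by rewrite !hornerE /g; ring.
  by rewrite normrM gtr0_norm// mulrC -ltr_pdivlMr// pf.
- move=> l Dl; have /andP[h0 h1] := h01 tau0 Dl.
  by rewrite ger0_norm ?(ltW h0)// (le_trans (ltW h1))// lerDl mulr_ge0// ltW.
- move=> l Dl; have /andP[rc rC] := r_bounds tau0 Dl; rewrite /g ger0_norm.
    by rewrite lerD2l ler_wpM2l// ltW.
  by rewrite addr_ge0// mulr_ge0 ?(ltW tau0)// (le_trans _ rc)// ltW.
- by move=> l Dl; exact: h_resolvent.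
Qed.

Lemma J_funE tau x : 0 < tau -> J_fun D h tau x = tau / 2 * inner x (S tau x).
Proof.
move=> tau0; rewrite /J_fun; have [_ _ ->] := cfc_h_inverse tau0.
by rewrite addrC addKr innerZr mulrCA mulrA.
Qed.

Lemma cfc_h_contraction tau : 0 < tau -> exists2 q, 0 <= q < 1 &
  forall x, `|cfc D (h tau) x| <= q * `|x|.
Proof.
move=> tau0; exists ((1 + tau * c)^-1).
  by rewrite invr_ge0 addr_ge0 ?mulr_ge0 ?ltW//= invf_lt1 ?ltrDl ?ltr_wpDr ?mulr_gt0 ?mulr_ge0 ?ltW.
have q0 : 0 <= (1 + tau * c)^-1 by rewrite invr_ge0 addr_ge0 ?mulr_ge0 ?ltW.
move=> x; apply: cfc_le => //; first exact: h_approximable.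
move=> l Dl; have /andP[h0 _] := h01 tau0 Dl; have /andP[_ hq] := h_bounds tau0 Dl.
by rewrite ger0_norm// ltW.
Qed.

Variable rstar : R -> R.
Hypothesis r_cvg : forall eps, 0 < eps -> \forall tau \near 0^'+,
  forall l, spec D l -> `|r_fun h tau l - rstar l| < eps.

Lemma exists_r_close (eps a : R) : 0 < eps -> 0 < a -> exists tau, [/\ 0 < tau, tau < a &
  forall l, spec D l -> `|r_fun h tau l - rstar l| < eps].
Proof.
move=> eps0 a0; near (0 : R)^'+ => tau; exists tau; split => //.
by near: tau; exact: r_cvg.
Unshelve. all: by end_near. Qed.

Lemma rstar_approximable : approximable (spec D) rstar.
Proof.
move=> e e0; have e20 : 0 < e / 2 by rewrite divr_gt0.
have [tau [tau0 _ Ht]] := exists_r_close e20 ltr01.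
have [p pf] := r_approximable tau0 e20; exists p => l Dl.
rewrite -(subrKA (r_fun h tau l)) (le_lt_trans (ler_normD _ _))//.
by have := pf _ Dl; have := Ht _ Dl; lra.
Qed.

Lemma rstar_bounds l : spec D l -> c <= rstar l <= C.
Proof.
move=> Dl; apply/andP; split; apply/ler_addgt0Pr => e e0;
  have [tau [tau0 _ /(_ _ Dl)]] := exists_r_close e0 ltr01;
  have /andP[] := r_bounds tau0 Dl; rewrite ltr_norml => ? ? /andP[]; lra.
Qed.

Let Sstar := cfc D rstar.

Lemma J_fun_cvg x : J_fun D h tau x / tau @[tau --> 0^'+] --> 2^-1 * inner x (Sstar x).
Proof.
apply/cvgrPdist_le => e e0.
have x1 : 0 < `|x| ^+ 2 + 1 by rewrite ltr_wpDl// sqr_ge0.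
have d0 : 0 < e / (`|x| ^+ 2 + 1) by rewrite divr_gt0.
near=> tau.
have tau0 : 0 < tau by near: tau; exact: nbhs_right_gt.
rewrite J_funE//.
have -> : 2^-1 * inner x (Sstar x) - tau / 2 * inner x (S tau x) / tau =
    2^-1 * inner x (Sstar x - S tau x).
  by rewrite innerBr; field; rewrite gt_eqF.
have close : `|S tau x - Sstar x| <= e / (`|x| ^+ 2 + 1) * `|x|.
  apply: cfc_close => //; [exact: r_approximable|exact: rstar_approximable|exact: ltW|].
  by move=> l Dl; apply: ltW; move: l Dl; near: tau; exact: r_cvg.
rewrite normrM ger0_norm ?invr_ge0// ler_pdivrMl//.
rewrite (le_trans (abs_inner_le _ _))// distrC.
rewrite (le_trans (ler_wpM2l (normr_ge0 x) close))// mulrCA -expr2 mulrAC.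
rewrite ler_pdivrMr// ; have := sqr_ge0 `|x|; nra.
Unshelve. all: by end_near. Qed.

Lemma J_starE x : J_star D h x = 2^-1 * inner x (Sstar x).
Proof. exact: cvg_lim (J_fun_cvg (x := x)). Qed.

End resolvent_family.

(** * Variational regularization by plug-and-play iterations *)

Theorem theorem5 (R : realType) (X Y : hilbertType R)
    (sepX : separable X) (sepY : separable Y)
    (D : {linear X -> X}) (D_bounded : continuous D)
    (D_self_adjoint : self_adjoint D)
    (D_posdef : forall x : X, x != 0 -> 0 < inner x (D x))
    (D_below : exists2 c : R, 0 < c & forall x : X, c * `|x| <= `|D x|)
    (D_contractive : opnorm D < 1)
    (A : {linear X -> Y}) (A_bounded : continuous A) (A_norm : opnorm A = 1)
    (h : R -> R -> R) (h_cont : forall tau : R, 0 < tau -> continuous (h tau))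
    (A1 : forall tau l : R, 0 < tau -> spec D l -> 0 < h tau l < 1)
    (rstar : R -> R)
    (A2_unif : forall eps : R, 0 < eps -> \forall tau \near 0^'+,
        forall l, spec D l -> `|r_fun h tau l - rstar l| < eps)
    (A2_rate : (fun tau : R =>
        sup [set `|r_fun h tau l - rstar l| | l in spec D] : R^o)
      =o_ (0^'+) (fun tau : R => tau : R^o))
    (A3_inf : (0 < ereal_inf (EFin @` r_values D h))%E)
    (A3_sup : (ereal_sup (EFin @` r_values D h) < +oo)%E) :
  (spec D `<=` `]0, 1[) /\
  (forall (tau : R) (x : X), 0 < tau ->
     J_fun D h tau x = tau / 2 * inner x (cfc D (r_fun h tau) x)) /\
  (forall (tau : R) (y : Y), 0 < tau ->
     exists xhat : X,
       argmin setT (objective A D h tau y) = [set xhat] /\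
       forall x : nat -> X,
         (forall k, x k.+1 = pnp_fbs A D h tau y (x k)) ->
         x k @[k --> \oo] --> xhat) /\
  (forall x : X, cvg (J_fun D h tau x / tau @[tau --> 0^'+])) /\
  (forall (xstar : X) (y : Y), y = A xstar ->
     exists xdag : X,
       argmin [set x | adjoint A (A x - y) = 0] (J_star D h) = [set xdag] /\
       forall (ydelta : R -> Y) (taudelta : R -> R) (xhat : R -> X),
         (forall delta, 0 < delta -> `|ydelta delta - y| <= delta) ->
         (forall delta, 0 < delta -> 0 < taudelta delta) ->
         (exists c1 c2 : R, 0 < c1 /\ c1 <= c2 /\
            \forall delta \near 0^'+,
              c1 * delta <= taudelta delta <= c2 * delta) ->
         (forall delta, 0 < delta ->
            argmin setT (objective A D h (taudelta delta) (ydelta delta))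
              (xhat delta)) ->
         xhat delta @[delta --> 0^'+] --> xdag).
Proof.
have D01 : spec D `<=` `]0, 1[.
  exact: spec_unit_interval D_bounded D_self_adjoint D_contractive D_posdef D_below.
have [c [C [c0 cC rb]]] := r_values_bounds A3_inf A3_sup.
pose Slin tau (tau0 : 0 < tau) :=
  cfc_r_linear D_bounded D_self_adjoint D01 h_cont A1 c0 cC rb tau0.
have JE tau x : 0 < tau ->
    J_fun D h tau x = tau / 2 * inner x (cfc D (r_fun h tau) x).
  by move=> tau0; exact: (J_funE D_bounded D_self_adjoint D01 h_cont A1 c0 cC rb).
have astar := rstar_approximable D01 h_cont A1 c0 cC rb A2_unif.
have Jcvg x := @J_fun_cvg _ _ _ _ D_bounded D_self_adjoint D01 h_cont A1 _ _ c0 cC rb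
  _ A2_unif x.
have JstarE x : J_star D h x = 2^-1 * inner x (cfc D rstar x).
  exact: (J_starE D_bounded D_self_adjoint D01 h_cont A1 c0 cC rb A2_unif).
split=> //; split=> //; split; last split.
- move=> tau y tau0.
  have [q q01 Hq] := cfc_h_contraction D_bounded D_self_adjoint D01 h_cont A1 c0 cC rb tau0.
  have [HK _ _] := cfc_h_inverse D_bounded D_self_adjoint D01 h_cont A1 c0 cC rb tau0.
  have Hlin : linear (cfc D (h tau)).
    by apply: cfc_is_linear => //; exact: h_approximable.
  have [|p pE pcvg] := @contraction_iterates R X (pnp_fbs A D h tau y) q q01.
    move=> x z; rewrite /pnp_fbs -[X in `|X|]addrC -scaleN1r -Hlin.
    set d := (X in cfc _ _ X); have -> : d = (x - z) - adjoint A (A (x - z)).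
      by rewrite /d (linearB A) !adjointB//; vector_ring.
    rewrite (le_trans (Hq _))// ler_wpM2l ?gradient_step_le//.
    by case/andP: q01.
  exists p; split => //.
  pose S : {linear X -> X} := HB.pack (cfc D (r_fun h tau))
    (GRing.isLinear.Build R X X _ (cfc D (r_fun h tau)) (Slin tau tau0)).
  apply: (@tikhonov_argmin _ _ _ A A_bounded S c _ c0 _ tau y) => //.
  + by apply: cfc_self_adjoint => //; exact: (r_approximable D01 h_cont A1 c0 cC rb).
  + by move=> x; apply: (cfc_r_form_ge D_bounded D_self_adjoint D01 h_cont A1 c0 cC rb).
  + by move=> x; rewrite /objective JE.
  + have := HK (p - adjoint A (A p - y)); rewrite -/(pnp_fbs A D h tau y p) pE /=.
    move=> E; rewrite -[tau *: _](addKr p) E; vector_ring.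
- by move=> x; apply/cvg_ex; exists (2^-1 * inner x (cfc D rstar x)).
- move=> xs y ->.
  have Sstar_lin : linear (cfc D rstar) by exact: cfc_is_linear.
  pose S : {linear X -> X} := HB.pack (cfc D rstar)
    (GRing.isLinear.Build R X X _ (cfc D rstar) Sstar_lin).
  have rsb := rstar_bounds rb A2_unif.
  have Ssa : self_adjoint S by exact: cfc_self_adjoint.
  have Sge x : c * `|x| ^+ 2 <= inner x (S x).
    exact: (cfc_form_ge D_bounded D_self_adjoint _ astar cC rsb).
  have Scont : continuous S.
    apply: (@le_continuous_linear _ _ _ S C) => x; apply: cfc_le => //.
      by rewrite ltW// (lt_le_trans c0).
    by move=> l /rsb/andP[rc rC]; rewrite ger0_norm// (le_trans (ltW c0)).
  have [xd Exd [Axd xdw]] := minimal_solution A_bounded Ssa c0 Sge Scont xs JstarE.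
  exists xd; split => // yd taud xh ydle taud0 [c1 [c2 [c10 [c12 ctau]]]] xhmin.
  have C0 : 0 < C by exact: (lt_le_trans c0 cC).
  pose n2 := `|xd| ^+ 2; have n20 : 0 <= n2 by exact: sqr_ge0.
  (* [B] bounds the squared norms of the regularized solutions, [Q] their distance
     to [xd], and [K * delta] their squared residuals. *)
  pose B := (1 + C * n2) / c.
  have B0 : 0 <= B by rewrite divr_ge0 ?(ltW c0)// addr_ge0// mulr_ge0// ltW.
  pose Q := B + 1 + `|xd|.
  have Q0 : 0 <= Q by rewrite !addr_ge0.
  pose K := 4 + 2 * c2 * C * n2.
  have c20 : 0 < c2 by exact: (lt_le_trans c10 c12).
  have K0 : 0 < K by rewrite ltr_wpDr// !mulr_ge0 ?(ltW c20) ?(ltW C0).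
  apply/cvgrPdist_le => e e0.
  pose E := c * e ^+ 2; have E0 : 0 < E by rewrite mulr_gt0// exprn_gt0.
  (* Of the error budget [E], the noise and the distance of the forms get a quarter
     each, and the two parts of the cross term, which is doubled, an eighth. *)
  have [|w xdw'] := xdw (E / (8 * (Q + 1))).
    by rewrite divr_gt0// mulr_gt0// ltr_wpDl.
  pose eta := E / (8 * (`|w| + 1)).
  have eta0 : 0 < eta by rewrite divr_gt0// mulr_gt0// ltr_wpDl.
  pose eps := E / (4 * (B + n2 + 1)).
  have eps0 : 0 < eps by rewrite divr_gt0// mulr_gt0// ltr_wpDl// addr_ge0.
  have [r r0 Hr] : exists2 r, 0 < r & forall tau, 0 < tau -> tau < r ->
      forall l, spec D l -> `|r_fun h tau l - rstar l| < eps.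
    have [r /= r0 Hr] := A2_unif _ eps0; exists r => // tau tau0 taur.
    by apply: Hr => //=; rewrite sub0r normrN gtr0_norm.
  near=> delta.
  have d0 : 0 < delta by near: delta; exact: nbhs_right_gt.
  have d1 : delta < 1 by near: delta; exact: nbhs_right_lt.
  have dc1 : delta < c1 by near: delta; exact: nbhs_right_lt.
  have dE : delta < c1 * (E / 4).
    by near: delta; apply: nbhs_right_lt; rewrite mulr_gt0// divr_gt0.
  have dK : delta < eta ^+ 2 / K.
    by near: delta; apply: nbhs_right_lt; rewrite divr_gt0// exprn_gt0.
  have dr : delta < r / c2 by near: delta; apply: nbhs_right_lt; rewrite divr_gt0.
  have /andP[tau1 tau2] : c1 * delta <= taud delta <= c2 * delta by near: delta.
  have tau0 := taud0 _ d0; have ydd := ydle _ d0.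
  have [_ /(_ xd I)] := xhmin _ d0; rewrite /objective !JE//.
  set tau := taud delta in tau0 tau1 tau2 *; set x := xh delta; set yd' := yd delta in ydd *.
  set T := cfc D (r_fun h tau); move=> minx; rewrite -Axd in ydd.
  have taur : tau < r by rewrite (le_lt_trans tau2)// mulrC -ltr_pdivlMr.
  have TS z : `|T z - S z| <= eps * `|z|.
    apply: cfc_close => //; [exact: (r_approximable D01 h_cont A1 c0 cC rb)|exact: ltW|].
    by move=> l Dl; apply: ltW; exact: Hr.
  have dtau : delta ^+ 2 / tau <= delta / c1.
    rewrite ler_pdivrMr// mulrAC ler_pdivlMr// expr2 -mulrA ler_pM2l// mulrC.
    by rewrite (le_trans _ tau1)// mulrC.
  have Txd : inner xd (T xd) <= C * n2.
    rewrite (le_trans (inner_le _ _))// /n2 expr2 mulrCA ler_wpM2l//.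
    exact: (cfc_r_le D_bounded D_self_adjoint D01 h_cont A1 c0 cC rb).
  have Txh : c * `|x| ^+ 2 <= inner x (T x).
    exact: (cfc_r_form_ge D_bounded D_self_adjoint D01 h_cont A1 c0 cC rb).
  have yd2 : `|A xd - yd'| ^+ 2 <= delta ^+ 2.
    by rewrite distrC ler_sqr ?nnegrE// ltW.
  have xB : `|x| ^+ 2 <= B.
    rewrite ler_pdivlMr// mulrC (le_trans Txh)//.
    have dt1 : delta ^+ 2 / tau <= 1.
      by rewrite (le_trans dtau)// ler_pdivrMr// mul1r ltW.
    rewrite ler_pdivrMr// mul1r in dt1.
    have := sqr_ge0 `|A x - yd'|; nra.
  have xB1 : `|x| <= B + 1 by have := sqr_ge0 (`|x| - 1); nra.
  have res : `|A x - A xd| <= eta.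
    rewrite -ler_sqr ?nnegrE ?(ltW eta0)// (@le_trans _ _ (K * delta))//; last first.
      by rewrite mulrC ltW// -ltr_pdivlMr.
    have r1 : `|A x - yd'| ^+ 2 <= delta ^+ 2 + c2 * delta * (C * n2).
      have : 0 <= inner x (T x) by rewrite (le_trans _ Txh)// mulr_ge0 ?sqr_ge0 ?ltW.
      have : tau * (C * n2) <= c2 * delta * (C * n2).
        by rewrite ler_wpM2r// mulr_ge0// ltW.
      nra.
    have -> : A x - A xd = (A x - yd') - (A xd - yd') by vector_ring.
    have := sqr_normB (A x - yd') (A xd - yd').
    have := sqr_normD (A x - yd') (A xd - yd').
    have := sqr_ge0 `|A x - yd' + (A xd - yd')|.
    rewrite /K; nra.
  have err := tikhonov_error A_bounded Ssa Sge w tau0 TS ydd minx.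
  have dxQ : `|x - xd| <= Q by rewrite (le_trans (ler_normB _ _))// lerD2r.
  have t1 : delta ^+ 2 / tau <= E / 4.
    by rewrite (le_trans dtau)// ler_pdivrMr// mulrC ltW.
  have t2 : eps * (`|x| ^+ 2 + `|xd| ^+ 2) <= E / 4.
    have -> : E / 4 = eps * (B + n2 + 1).
      by rewrite /eps; field; rewrite gt_eqF// ltr_wpDl// addr_ge0.
    by apply: ler_wpM2l; [exact: ltW|rewrite -/n2; lra].
  have t3 : `|A x - A xd| * `|w| <= E / 8.
    have -> : E / 8 = eta * (`|w| + 1).
      by rewrite /eta; field; rewrite gt_eqF// ltr_wpDl.
    by apply: ler_pM; rewrite // lerDl.
  have t4 : `|x - xd| * `|S xd - adjoint A w| <= E / 8.
    have -> : E / 8 = (Q + 1) * (E / (8 * (Q + 1))).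
      by field; rewrite gt_eqF// ltr_wpDl.
    by apply: ler_pM; rewrite // ?(ltW xdw')// (le_trans dxQ)// lerDl.
  have : c * `|x - xd| ^+ 2 <= c * e ^+ 2 by rewrite -/E; lra.
  by rewrite ler_pM2l// ler_sqr ?nnegrE ?(ltW e0)// distrC.
Unshelve. all: by end_near. Qed.
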